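(* Let $(H,\alpha)$ be a monoidal Hom-bialgebra over a commutative ring $k$. Then the category $\widetilde{\mathcal{H}}(\mathcal{YD})^{H}_{H}$ of right-right $(H,\alpha)$-Hom-Yetter-Drinfeld modules, with tensor product $(M\otimes N,\mu\otimes\nu)$ over $k$ equipped with the structure maps $$(m\otimes n)\lhd h=m\lhd h_1\otimes n\lhd h_2,\qquad m\otimes n\mapsto(m_{(0)}\otimes n_{(0)})\otimes m_{(1)}n_{(1)},$$ unit object $(k,id_k)$ with $x\lhd h=\varepsilon(h)x$ and $x\mapsto x\otimes 1_H$, associativity constraint $\tilde a_{M,N,P}((m\otimes n)\otimes p)=\mu(m)\otimes(n\otimes\pi^{-1}(p))$, unit constraints $\tilde l_M(x\otimes m)=x\mu(m)$, $\tilde r_M(m\otimes x)=x\mu(m)$, and prebraiding $$c_{M,N}:M\otimes N\to N\otimes M,\quad m\otimes n\mapsto\nu(n_{(0)})\otimes\mu^{-1}(m)\lhd n_{(1)},$$ is a prebraided monoidal category. It is a braided monoidal category if $(H,\alpha)$ is a monoidal Hom-Hopf algebra with a bijective antipode.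
   Context: Conventions: $k$ is a commutative ring, $\otimes=\otimes_k$, Sweedler notation without summation signs. $\widetilde{\mathcal{H}}(\mathcal{M}_k)$ is the category of pairs $(M,\mu)$, $M$ a $k$-module, $\mu$ a $k$-linear automorphism of $M$; morphisms $f:(M,\mu)\to(N,\nu)$ are $k$-linear maps with $\nu f=f\mu$; $(M,\mu)\otimes(N,\nu)=(M\otimes N,\mu\otimes\nu)$. A monoidal Hom-bialgebra $(H,\alpha)$ is an object of $\widetilde{\mathcal{H}}(\mathcal{M}_k)$ with a $k$-bilinear product, an element $1_H$, and $k$-linear maps $\Delta(h)=h_1\otimes h_2$, $\varepsilon:H\to k$ such that $\alpha(ab)=\alpha(a)\alpha(b)$, $\alpha(1_H)=1_H$, $\alpha(a)(bc)=(ab)\alpha(c)$, $a1_H=1_Ha=\alpha(a)$; $\Delta(\alpha(c))=\alpha(c_1)\otimes\alpha(c_2)$, $\varepsilon\alpha=\varepsilon$, $\alpha^{-1}(c_1)\otimes\Delta(c_2)=c_{11}\otimes(c_{12}\otimes\alpha^{-1}(c_2))$, $c_1\varepsilon(c_2)=\alpha^{-1}(c)=\varepsilon(c_1)c_2$; and $\Delta(ab)=\Delta(a)\Delta(b)$, $\Delta(1_H)=1_H\otimes1_H$, $\varepsilon(ab)=\varepsilon(a)\varepsilon(b)$, $\varepsilon(1_H)=1$. It is a monoidal Hom-Hopf algebra if there is a $k$-linear $S:H\to H$ (antipode) with $S\alpha=\alpha S$ and $S(h_1)h_2=\varepsilon(h)1_H=h_1S(h_2)$. A right $(H,\alpha)$-Hom-module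 is $(N,\nu)$ with a morphism $N\otimes H\to N$, $n\otimes h\mapsto n\lhd h$, in $\widetilde{\mathcal{H}}(\mathcal{M}_k)$ such that $(n\lhd g)\lhd\alpha(h)=\nu(n)\lhd(gh)$ and $n\lhd1_H=\nu(n)$. A right $(H,\alpha)$-Hom-comodule is $(N,\nu)$ with a morphism $N\to N\otimes H$, $n\mapsto n_{(0)}\otimes n_{(1)}$, in $\widetilde{\mathcal{H}}(\mathcal{M}_k)$ such that $\nu^{-1}(n_{(0)})\otimes\Delta(n_{(1)})=n_{(0)(0)}\otimes(n_{(0)(1)}\otimes\alpha^{-1}(n_{(1)}))$ and $n_{(0)}\varepsilon(n_{(1)})=\nu^{-1}(n)$. A right-right $(H,\alpha)$-Hom-Yetter-Drinfeld module is both, with $$n_{(0)}\lhd\alpha^{-1}(h_1)\otimes n_{(1)}\alpha^{-1}(h_2)=(n\lhd h_2)_{(0)}\otimes\alpha^{-1}(h_1(n\lhd h_2)_{(1)})$$ for all $h\in H$, $n\in N$. Morphisms are the right $H$-linear and right $H$-colinear morphisms of $\widetilde{\mathcal{H}}(\mathcal{M}_k)$. Prebraided monoidal means a natural family $c$ of morphisms satisfying both hexagon axioms but not required to be invertible; braided means $c$ is moreover invertible. *)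

(* Defs.v *)
From HB Require Import structures.
From mathcomp Require Import all_boot all_order all_algebra boolp.
Set Implicit Arguments.
Unset Strict Implicit.
Unset Printing Implicit Defensive.
Import GRing.Theory.
Local Open Scope ring_scope.
Local Open Scope quotient_scope.

Reserved Notation "m ⊗ n" (at level 45, left associativity).
Reserved Notation "n ◁ h" (at level 40, left associativity).
Reserved Notation "a ⋆ b" (at level 40, left associativity).
Reserved Notation "g ∘c f" (at level 40, left associativity).
Reserved Notation "A ⊠ B" (at level 40, left associativity).
Reserved Notation "f ⊠m g" (at level 40, left associativity).
Reserved Notation "\sw_ ( x , y <- t ) F"
  (at level 34, F at level 50, x at level 99, y at level 99, t at level 200,
   right associativity, format "\sw_ ( x ,  y  <-  t )  F").

(* M ⊗ N is presented as the quotient of the formal finite sums of pairs (m, n)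
   by the least congruence making (m, n) additive and balanced.  The scalar a
   sends the class of (m, n) to that of (a *: m, n), which is why opposites and
   general scalar combinations need no generators of their own. *)
Section Tensor.
Variables (k : comPzRingType) (M N : lmodType k).
Implicit Types (s t : seq (M * N)).

Inductive tensor_cong : seq (M * N) -> seq (M * N) -> Prop :=
| Tcong_refl s : tensor_cong s s
| Tcong_sym s t : tensor_cong s t -> tensor_cong t s
| Tcong_trans s t u : tensor_cong s t -> tensor_cong t u -> tensor_cong s u
| Tcong_cat s s' t t' :
    tensor_cong s s' -> tensor_cong t t' -> tensor_cong (s ++ t) (s' ++ t')
| Tcong_catC s t : tensor_cong (s ++ t) (t ++ s)
| Tcong_Dl m m' n : tensor_cong [:: (m + m', n)] [:: (m, n); (m', n)]
| Tcong_Dr m n n' : tensor_cong [:: (m, n + n')] [:: (m, n); (m, n')]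
| Tcong_Z a m n : tensor_cong [:: (a *: m, n)] [:: (m, a *: n)]
| Tcong_0 n : tensor_cong [:: (0, n)] [::].

Definition tensor_rel : rel (seq (M * N)) := fun s t => `[< tensor_cong s t >].

Lemma tensor_rel_equiv : equiv_class_of tensor_rel.
Proof.
split.
- by move=> s; apply/asboolP; apply: Tcong_refl.
- by move=> s t; apply/asboolP/asboolP; apply: Tcong_sym.
- by move=> t s u /asboolP h1 /asboolP h2; apply/asboolP; apply: Tcong_trans h1 h2.
Qed.

Canonical tensor_equiv := EquivRelPack tensor_rel_equiv.

Definition tensor := {eq_quot tensor_rel}.

HB.instance Definition _ := Choice.on tensor.

Definition tclass s : tensor := \pi_tensor s.

Lemma tclassP s t : reflect (tensor_cong s t) (tclass s == tclass t).
Proof. by apply: (iffP idP); [move/eqP/eqmodP/asboolP|move=> h; apply/eqP/eqmodP/asboolP]. Qed.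

Lemma tclass_eq s t : tensor_cong s t -> tclass s = tclass t.
Proof. by move/tclassP/eqP. Qed.

Lemma tclassK (x : tensor) : tclass (repr x) = x.
Proof. exact: reprK. Qed.

Lemma repr_cong s : tensor_cong (repr (tclass s)) s.
Proof. by apply/tclassP; rewrite tclassK. Qed.

Definition taction (a : k) s := [seq (a *: p.1, p.2) | p <- s].

Lemma taction_cong a s t :
  tensor_cong s t -> tensor_cong (taction a s) (taction a t).
Proof.
elim=> {s t} /=.
- by move=> s; apply: Tcong_refl.
- by move=> s t _ IH; apply: Tcong_sym.
- by move=> s t u _ h1 _ h2; apply: Tcong_trans h1 h2.
- by move=> s s' t t' _ h1 _ h2; rewrite /taction !map_cat; apply: Tcong_cat.
- by move=> s t; rewrite /taction !map_cat; apply: Tcong_catC.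
- by move=> m m' n; rewrite /taction /= scalerDr; apply: Tcong_Dl.
- by move=> m n n'; rewrite /taction /=; apply: Tcong_Dr.
- move=> b m n; rewrite /taction /= scalerA mulrC -scalerA.
  exact: Tcong_Z.
- by move=> n; rewrite /taction /= scaler0; apply: Tcong_0.
Qed.

Definition tadd (x y : tensor) : tensor := tclass (repr x ++ repr y).
Definition tzero : tensor := tclass [::].
Definition tscale (a : k) (x : tensor) : tensor := tclass (taction a (repr x)).
Definition topp (x : tensor) : tensor := tscale (-1) x.

Lemma tadd_class s t : tadd (tclass s) (tclass t) = tclass (s ++ t).
Proof. by apply: tclass_eq; apply: Tcong_cat; apply: repr_cong. Qed.

Lemma tscale_class a s : tscale a (tclass s) = tclass (taction a s).
Proof. by apply: tclass_eq; apply: taction_cong; apply: repr_cong. Qed.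

Lemma taddA : associative tadd.
Proof.
move=> x y z; rewrite -[x]tclassK -[y]tclassK -[z]tclassK.
by rewrite !tadd_class catA.
Qed.

Lemma taddC : commutative tadd.
Proof.
move=> x y; rewrite -[x]tclassK -[y]tclassK !tadd_class.
exact/tclass_eq/Tcong_catC.
Qed.

Lemma tadd0 : left_id tzero tadd.
Proof. by move=> x; rewrite -[x]tclassK tadd_class. Qed.

Lemma tscale_pairD (a b : k) s :
  tensor_cong (taction (a + b) s) (taction a s ++ taction b s).
Proof.
elim: s => [|[m n] s IH]; first exact: Tcong_refl.
rewrite /taction /= scalerDl -[X in tensor_cong X]cat1s.
apply: (Tcong_trans (Tcong_cat (Tcong_Dl _ _ _) IH)) => /=.
rewrite -[X in tensor_cong X _]cat1s -[X in tensor_cong _ X]cat1s.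
apply: Tcong_cat; first exact: Tcong_refl.
rewrite -[X in tensor_cong X _]cat1s catA -[X in tensor_cong _ (_ ++ X)]cat1s.
rewrite [X in tensor_cong _ X]catA.
by apply: Tcong_cat; [apply: Tcong_catC | apply: Tcong_refl].
Qed.

Lemma tscaleDl (x : tensor) a b :
  tscale (a + b) x = tadd (tscale a x) (tscale b x).
Proof.
rewrite -[x]tclassK !tscale_class tadd_class.
exact/tclass_eq/tscale_pairD.
Qed.

Lemma tscale0 (x : tensor) : tscale 0 x = tzero.
Proof.
rewrite -[x]tclassK tscale_class; apply: tclass_eq.
elim: (repr x) => [|[m n] s IH]; first exact: Tcong_refl.
rewrite /taction /= scale0r -cat1s -[X in tensor_cong _ X]cat0s.
by apply: Tcong_cat => //; apply: Tcong_0.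
Qed.

Lemma tscale1 : left_id 1 tscale.
Proof.
move=> x; rewrite -[x]tclassK tscale_class /taction; congr tclass.
rewrite -[RHS]map_id; apply: eq_map => -[m n] /=.
by rewrite scale1r.
Qed.

Lemma taddN : left_inverse tzero topp tadd.
Proof. by move=> x; rewrite -{2}[x]tscale1 -tscaleDl addNr tscale0. Qed.

HB.instance Definition _ :=
  GRing.isZmodule.Build tensor taddA taddC tadd0 taddN.

Lemma tclassD s t : tclass s + tclass t = tclass (s ++ t).
Proof. exact: tadd_class. Qed.

Lemma tscaleA (a b : k) (x : tensor) : tscale a (tscale b x) = tscale (a * b) x.
Proof.
rewrite -[x]tclassK !tscale_class /taction -map_comp; congr tclass.
by apply: eq_map => -[m n] /=; rewrite scalerA.
Qed.

Lemma tscaleDr : right_distributive tscale +%R.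
Proof.
move=> a x y; rewrite -[x]tclassK -[y]tclassK tclassD !tscale_class tclassD.
by rewrite /taction map_cat.
Qed.

HB.instance Definition _ :=
  GRing.Zmodule_isLmodule.Build k tensor tscaleA tscale1 tscaleDr
    (fun x => tscaleDl x).

Lemma tclassZ a s : a *: tclass s = tclass (taction a s).
Proof. exact: tscale_class. Qed.

Definition pure (m : M) (n : N) : tensor := tclass [:: (m, n)].

End Tensor.

Arguments pure {k M N}.
Arguments tensor {k} (M N)%_type_scope.

Notation "M ⊗ N" := (tensor M N) : type_scope.
Notation "m ⊗ n" := (pure m n) : ring_scope.

Definition is_bilinear (k : comPzRingType) (M N P : lmodType k)
    (f : M -> N -> P) : Prop :=
  (forall m, linear (f m)) /\ (forall n, linear (fun m => f m n)).

(* Sweedler summation: if t is a sum of x_i ⊗ y_i then \sw_(x, y <- t) F x y is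
   the sum of the F x_i y_i.  It is computed from one chosen expression of t as
   a sum of pure tensors; for F bilinear in x and y the result does not depend
   on that choice and is the linear extension of F (sweedler_pure and
   sweedler_linear below). *)
Definition sweedler (k : comPzRingType) (M N : lmodType k) (P : nmodType)
    (t : M ⊗ N) (F : M -> N -> P) : P :=
  \sum_(p <- repr t) F p.1 p.2.
Arguments sweedler {k M N P}.

Notation "\sw_ ( x , y <- t ) F" := (sweedler t (fun x y => F)) : ring_scope.

Section TensorTheory.
Variables (k : comPzRingType) (M N : lmodType k).

Lemma pure_bilinear : is_bilinear (@pure k M N).
Proof.
split=> [m a n n' | n a m m'].
- rewrite /pure [LHS](tclass_eq (Tcong_Dr _ _ _)).
  rewrite -(tclassD [:: (m, a *: n)] [:: (m, n')]); congr (_ + _).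
  by rewrite tclassZ; apply: tclass_eq; apply/Tcong_sym/Tcong_Z.
- rewrite /pure [LHS](tclass_eq (Tcong_Dl _ _ _)).
  rewrite -(tclassD [:: (a *: m, n)] [:: (m', n)]); congr (_ + _).
  by rewrite tclassZ.
Qed.

Lemma tensor_sum_pure (t : M ⊗ N) : t = \sum_(p <- repr t) (p.1 ⊗ p.2).
Proof.
rewrite -{1}[t]tclassK; elim: (repr t) => [|[m n] s IH]; first by rewrite big_nil.
by rewrite big_cons -IH tclassD.
Qed.

Section Lift.
Variables (P : lmodType k) (F : M -> N -> P).
Hypothesis bF : is_bilinear F.

Let FDl m m' n : F (m + m') n = F m n + F m' n.
Proof. by have := bF.2 n 1 m m'; rewrite !scale1r. Qed.

Let FDr m n n' : F m (n + n') = F m n + F m n'.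
Proof. by have := bF.1 m 1 n n'; rewrite !scale1r. Qed.

Let F0l n : F 0 n = 0.
Proof. by apply: (addrI (F 0 n)); rewrite -FDl !addr0. Qed.

Let F0r m : F m 0 = 0.
Proof. by apply: (addrI (F m 0)); rewrite -FDr !addr0. Qed.

Let FZl a m n : F (a *: m) n = a *: F m n.
Proof. by have := bF.2 n a m 0; rewrite !addr0 F0l addr0. Qed.

Let FZr a m n : F m (a *: n) = a *: F m n.
Proof. by have := bF.1 m a n 0; rewrite !addr0 F0r addr0. Qed.

Lemma lift_cong (s t : seq (M * N)) : tensor_cong s t ->
  \sum_(p <- s) F p.1 p.2 = \sum_(p <- t) F p.1 p.2.
Proof.
elim=> {s t} //=.
- by move=> s t u _ -> _ ->.
- by move=> s s' t t' _ h1 _ h2; rewrite !big_cat /= h1 h2.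
- by move=> s t; rewrite !big_cat /= addrC.
- by move=> m m' n; rewrite !big_cons !big_nil /= !addr0 FDl.
- by move=> m n n'; rewrite !big_cons !big_nil /= !addr0 FDr.
- by move=> a m n; rewrite !big_cons !big_nil /= !addr0 FZl FZr.
- by move=> n; rewrite big_cons !big_nil /= addr0 F0l.
Qed.

Lemma sweedler_class s : sweedler (tclass s) F = \sum_(p <- s) F p.1 p.2.
Proof. exact/lift_cong/repr_cong. Qed.

Lemma sweedler_pure m n : sweedler (m ⊗ n) F = F m n.
Proof. by rewrite sweedler_class big_cons big_nil addr0. Qed.

Lemma sweedler_linear : linear (sweedler^~ F).
Proof.
move=> a x y; rewrite -[x]tclassK -[y]tclassK.
rewrite tclassZ tclassD !sweedler_class.
rewrite big_cat /= /taction big_map scaler_sumr; congr (_ + _).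
by apply: eq_bigr => p _; rewrite FZl.
Qed.

End Lift.

Lemma tensor_ext (P : lmodType k) (f g : M ⊗ N -> P) :
  linear f -> linear g -> (forall m n, f (m ⊗ n) = g (m ⊗ n)) -> f =1 g.
Proof.
move=> lf lg fg t; rewrite [t]tensor_sum_pure.
have l0 (h : M ⊗ N -> P) : linear h -> h 0 = 0.
  move=> lh; have := lh 1 0 0; rewrite !scale1r !addr0 => E.
  by apply: (addrI (h 0)); rewrite addr0 -E.
elim: (repr t) => [|p s IH]; first by rewrite big_nil !l0.
rewrite big_cons; have := lf 1 (p.1 ⊗ p.2) (\sum_(q <- s) (q.1 ⊗ q.2)).
have := lg 1 (p.1 ⊗ p.2) (\sum_(q <- s) (q.1 ⊗ q.2)).
by rewrite !scale1r => -> ->; rewrite fg IH.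
Qed.

End TensorTheory.

Section TensorMap.
Variables (k : comPzRingType) (M N M' N' : lmodType k).

Definition tmap (f : M -> M') (g : N -> N') (t : M ⊗ N) : M' ⊗ N' :=
  \sw_(m, n <- t) (f m ⊗ g n).

Lemma tmap_bilinear (f : M -> M') (g : N -> N') : linear f -> linear g ->
  is_bilinear (fun m n => f m ⊗ g n : M' ⊗ N').
Proof.
move=> lf lg; split=> [m a x y|n a x y].
- by rewrite lg; apply: (pure_bilinear _ _).1.
- by rewrite lf; apply: (pure_bilinear _ _).2.
Qed.

Lemma tmap_linear (f : M -> M') (g : N -> N') : linear f -> linear g -> linear (tmap f g).
Proof. by move=> lf lg; apply/sweedler_linear/tmap_bilinear. Qed.

HB.instance Definition _ (f : {linear M -> M'}) (g : {linear N -> N'}) :=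
  GRing.isLinear.Build k (M ⊗ N)%type (M' ⊗ N')%type *:%R (tmap f g)
    (tmap_linear (linearP f) (linearP g)).

End TensorMap.

Lemma tmapK (k : comPzRingType) (M N M' N' : lmodType k)
    (f : {linear M -> M'}) (f' : {linear M' -> M})
    (g : {linear N -> N'}) (g' : {linear N' -> N}) :
  cancel f f' -> cancel g g' -> cancel (tmap f g) (tmap f' g').
Proof.
move=> fK gK; apply: (tensor_ext (f := tmap f' g' \o tmap f g) (g := idfun)).
- exact: linearP.
- by move=> a x y.
- move=> m n /=; rewrite /tmap !sweedler_pure ?fK ?gK //;
    exact: tmap_bilinear (linearP _) (linearP _).
Qed.

Record category := Category {
  obj :> Type;
  hom : obj -> obj -> Type;
  idc : forall A, hom A A;
  comp : forall A B C, hom B C -> hom A B -> hom A C;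
  comp1c : forall A B (f : hom A B), comp (idc B) f = f;
  compc1 : forall A B (f : hom A B), comp f (idc A) = f;
  compA : forall A B C D (h : hom C D) (g : hom B C) (f : hom A B),
    comp h (comp g f) = comp (comp h g) f
}.
Arguments idc {c}.
Notation "g ∘c f" := (comp g f).

Definition inverse_homs (C : category) (A B : C) (f : hom A B) (g : hom B A) :=
  g ∘c f = idc A /\ f ∘c g = idc B.

Definition is_iso (C : category) (A B : C) (f : hom A B) : Prop :=
  exists g : hom B A, inverse_homs f g.

Record monoidal_data (C : category) := MonoidalData {
  tens : C -> C -> C;
  tensm : forall A A' B B',
    hom A A' -> hom B B' -> hom (tens A B) (tens A' B');
  unitc : C;
  assc : forall A B D, hom (tens (tens A B) D) (tens A (tens B D));
  lunit : forall A, hom (tens unitc A) A;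
  runit : forall A, hom (tens A unitc) A
}.
Arguments tens {C}.
Arguments tensm {C} m {A A' B B'}.
Arguments unitc {C}.
Arguments assc {C}.
Arguments lunit {C}.
Arguments runit {C}.

Section MonoidalLaws.
Variables (C : category) (V : monoidal_data C).
Local Notation "A ⊠ B" := (tens V A B).
Local Notation "f ⊠m g" := (tensm V f g).

Record is_monoidal : Prop := IsMonoidal {
  tensm_id : forall A B : C, idc A ⊠m idc B = idc (A ⊠ B);
  tensm_comp : forall (A A' A'' B B' B'' : C)
      (f' : hom A' A'') (f : hom A A') (g' : hom B' B'') (g : hom B B'),
    (f' ∘c f) ⊠m (g' ∘c g) = (f' ⊠m g') ∘c (f ⊠m g);
  assc_nat : forall (A A' B B' D D' : C)
      (f : hom A A') (g : hom B B') (h : hom D D'),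
    assc V A' B' D' ∘c ((f ⊠m g) ⊠m h) = (f ⊠m (g ⊠m h)) ∘c assc V A B D;
  lunit_nat : forall (A A' : C) (f : hom A A'),
    lunit V A' ∘c (idc (unitc V) ⊠m f) = f ∘c lunit V A;
  runit_nat : forall (A A' : C) (f : hom A A'),
    runit V A' ∘c (f ⊠m idc (unitc V)) = f ∘c runit V A;
  assc_iso : forall A B D : C, is_iso (assc V A B D);
  lunit_iso : forall A : C, is_iso (lunit V A);
  runit_iso : forall A : C, is_iso (runit V A);
  pentagon : forall A B D E : C,
    (idc A ⊠m assc V B D E) ∘c assc V A (B ⊠ D) E ∘c (assc V A B D ⊠m idc E)
      = assc V A B (D ⊠ E) ∘c assc V (A ⊠ B) D E;
  triangle : forall A B : C,
    (idc A ⊠m lunit V B) ∘c assc V A (unitc V) B = runit V A ⊠m idc B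
}.

Variable c : forall A B : C, hom (A ⊠ B) (B ⊠ A).

Record is_prebraiding : Prop := IsPrebraiding {
  prebraiding_nat : forall (A A' B B' : C) (f : hom A A') (g : hom B B'),
    c A' B' ∘c (f ⊠m g) = (g ⊠m f) ∘c c A B;
  hexagon1 : forall A B D : C,
    assc V B D A ∘c c A (B ⊠ D) ∘c assc V A B D
      = (idc B ⊠m c A D) ∘c assc V B A D ∘c (c A B ⊠m idc D);
  hexagon2 : exists2 asscV : forall A B D : C,
        hom (A ⊠ (B ⊠ D)) ((A ⊠ B) ⊠ D),
      (forall A B D, inverse_homs (assc V A B D) (asscV A B D)) &
      forall A B D : C,
        asscV D A B ∘c c (A ⊠ B) D ∘c asscV A B D
          = (c A D ⊠m idc B) ∘c asscV A D B ∘c (idc A ⊠m c B D)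
}.

Definition is_braiding : Prop :=
  is_prebraiding /\ forall A B : C, is_iso (c A B).

End MonoidalLaws.

Record hobj (k : comPzRingType) := HObj {
  hcar :> lmodType k;
  aut : {linear hcar -> hcar};
  autV : {linear hcar -> hcar};
  autK : cancel aut autV;
  autVK : cancel autV aut
}.

Definition htens (k : comPzRingType) (M N : hobj k) : hobj k :=
  {| hcar := (M ⊗ N)%type;
     aut := tmap (aut M) (aut N);
     autV := tmap (autV M) (autV N);
     autK := tmapK (@autK k M) (@autK k N);
     autVK := tmapK (@autVK k M) (@autVK k N) |}.

Definition hunit (k : comPzRingType) : hobj k :=
  {| hcar := k^o; aut := idfun; autV := idfun;
     autK := fun=> erefl; autVK := fun=> erefl |}.

Definition is_hmor (k : comPzRingType) (M N : hobj k) (f : M -> N) : Prop :=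
  linear f /\ forall m, aut N (f m) = f (aut M m).

Record mhbialg (k : comPzRingType) := MHBialg {
  mhb :> hobj k;
  hmul : mhb -> mhb -> mhb;
  hone : mhb;
  hcomul : {linear mhb -> (mhb ⊗ mhb)%type};
  hcounit : {linear mhb -> k^o};
  hmul_bilinear : is_bilinear hmul;
  aut_hmul : forall a b, aut mhb (hmul a b) = hmul (aut mhb a) (aut mhb b);
  aut_hone : aut mhb hone = hone;
  hmulA : forall a b c, hmul (aut mhb a) (hmul b c) = hmul (hmul a b) (aut mhb c);
  hmulr1 : forall a, hmul a hone = aut mhb a;
  hmul1r : forall a, hmul hone a = aut mhb a;
  hcomul_aut : forall c,
    hcomul (aut mhb c) = \sw_(c1, c2 <- hcomul c) (aut mhb c1 ⊗ aut mhb c2);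
  hcounit_aut : forall c, hcounit (aut mhb c) = hcounit c;
  hcomulA : forall c,
    \sw_(c1, c2 <- hcomul c) (autV mhb c1 ⊗ hcomul c2)
      = \sw_(c1, c2 <- hcomul c) \sw_(c11, c12 <- hcomul c1)
          (c11 ⊗ (c12 ⊗ autV mhb c2));
  hcounitr : forall c, \sw_(c1, c2 <- hcomul c) (hcounit c2 *: c1) = autV mhb c;
  hcounitl : forall c, \sw_(c1, c2 <- hcomul c) (hcounit c1 *: c2) = autV mhb c;
  hcomulM : forall a b,
    hcomul (hmul a b) = \sw_(a1, a2 <- hcomul a) \sw_(b1, b2 <- hcomul b)
                          (hmul a1 b1 ⊗ hmul a2 b2);
  hcomul1 : hcomul hone = hone ⊗ hone;
  hcounitM : forall a b, hcounit (hmul a b) = hcounit a * hcounit b :> k;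
  hcounit1 : hcounit hone = 1 :> k
}.
Arguments hone {k}.
Notation "a ⋆ b" := (hmul a b) : ring_scope.

Definition is_antipode (k : comPzRingType) (H : mhbialg k)
    (S : {linear H -> H}) : Prop :=
  [/\ forall h, S (aut H h) = aut H (S h),
      forall h, \sw_(h1, h2 <- hcomul H h) (S h1 ⋆ h2) = hcounit H h *: hone H &
      forall h, \sw_(h1, h2 <- hcomul H h) (h1 ⋆ S h2) = hcounit H h *: hone H].

Section YetterDrinfeld.
Variables (k : comPzRingType) (H : mhbialg k).

(* No axiom is imposed here, so that structure maps such as those of a tensor
   product can be written down before they are known to satisfy is_yd. *)
Record yd_data := YDData {
  ydobj :> hobj k;
  act : ydobj ⊗ H -> ydobj;
  coact : ydobj -> ydobj ⊗ H
}.

Definition ract (N : yd_data) (n : N) (h : H) : N := act (n ⊗ h).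
Local Notation "n ◁ h" := (ract n h) : ring_scope.

Record is_hom_module (N : yd_data) : Prop := IsHomModule {
  act_hmor : @is_hmor k (htens N H) N (@act N);
  ractA : forall (n : N) (g h : H), (n ◁ g) ◁ aut H h = aut N n ◁ (g ⋆ h);
  ract1 : forall n : N, n ◁ hone H = aut N n
}.

Record is_hom_comodule (N : yd_data) : Prop := IsHomComodule {
  coact_hmor : @is_hmor k N (htens N H) (@coact N);
  coactA : forall n : N,
    \sw_(n0, n1 <- coact n) (autV N n0 ⊗ hcomul H n1)
      = \sw_(n0, n1 <- coact n) \sw_(n00, n01 <- coact n0)
          (n00 ⊗ (n01 ⊗ autV H n1));
  coact1 : forall n : N,
    \sw_(n0, n1 <- coact n) (hcounit H n1 *: n0) = autV N n
}.

Definition yd_compatible (N : yd_data) : Prop := forall (h : H) (n : N),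
  \sw_(n0, n1 <- coact n) \sw_(h1, h2 <- hcomul H h)
     ((n0 ◁ autV H h1) ⊗ (n1 ⋆ autV H h2))
  = \sw_(h1, h2 <- hcomul H h) \sw_(x0, x1 <- coact (n ◁ h2))
     (x0 ⊗ autV H (h1 ⋆ x1)).

Definition is_yd (N : yd_data) : Prop :=
  [/\ is_hom_module N, is_hom_comodule N & yd_compatible N].

Definition is_yd_mor (M N : yd_data) (f : M -> N) : Prop :=
  [/\ is_hmor f,
      forall (m : M) (h : H), f (m ◁ h) = f m ◁ h &
      forall m : M, coact (f m) = \sw_(m0, m1 <- coact m) (f m0 ⊗ m1)].

Record yd := YD { yd_of :> yd_data; ydP : is_yd yd_of }.

Record yd_hom (M N : yd_data) := YDHom {
  yd_fun :> M -> N;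
  yd_homP : is_yd_mor yd_fun
}.

Lemma yd_hom_eq (M N : yd_data) (f g : yd_hom M N) : f =1 g -> f = g.
Proof.
case: f g => [f fP] [g gP] /= /funext fg; case: _ / fg gP => gP.
by rewrite (Prop_irrelevance fP gP).
Qed.

Lemma sweedler_map1 (M N P : lmodType k) (f : M -> N) (g : N -> P)
    (t : M ⊗ H) : linear f -> linear g ->
  \sw_(y, z <- \sw_(m, x <- t) (f m ⊗ x)) (g y ⊗ z) = \sw_(m, x <- t) (g (f m) ⊗ x).
Proof.
move=> lf lg; have lid : linear (@idfun H) by [].
have bf := tmap_bilinear lf lid; have bg := tmap_bilinear lg lid.
have lgf : linear (g \o f) by move=> a x y /=; rewrite lf lg.
have bgf := tmap_bilinear lgf lid.
move: t; apply: (tensor_ext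
  (f := fun t => \sw_(y, z <- \sw_(m, x <- t) (f m ⊗ x)) (g y ⊗ z))
  (g := fun t => \sw_(m, x <- t) (g (f m) ⊗ x))).
- by move=> a x y /=; rewrite (sweedler_linear bf) (sweedler_linear bg).
- exact: sweedler_linear bgf.
- by move=> m x /=; rewrite (sweedler_pure bf) (sweedler_pure bg) (sweedler_pure bgf).
Qed.

Lemma yd_id_mor (M : yd_data) : is_yd_mor (@idfun M).
Proof.
split; [by split=> // a x y | by [] | move=> m; exact: tensor_sum_pure].
Qed.

Lemma yd_comp_mor (M N P : yd_data) (g : yd_hom N P) (f : yd_hom M N) :
  is_yd_mor (g \o f).
Proof.
case: f g => f [[lf af] rf cf] [g [[lg ag] rg cg]] /=; split=> [||m] /=.
- split=> [a x y|m] /=; first by rewrite lf lg.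
  by rewrite ag af.
- by move=> m h; rewrite rf rg.
- by rewrite cg cf sweedler_map1.
Qed.

Definition yd_cat : category.
Proof.
refine {| obj := yd;
          hom := yd_hom;
          idc := fun M => YDHom (yd_id_mor M);
          comp := fun M N P g f => YDHom (yd_comp_mor g f) |}.
all: by move=> *; apply: yd_hom_eq.
Defined.

Definition yd_tens (M N : yd_data) : yd_data :=
  {| ydobj := htens M N;
     act := fun t : (M ⊗ N) ⊗ H =>
       \sw_(x, h <- t) \sw_(m, n <- x) \sw_(h1, h2 <- hcomul H h)
         ((m ◁ h1) ⊗ (n ◁ h2));
     coact := fun x : M ⊗ N =>
       \sw_(m, n <- x) \sw_(m0, m1 <- coact m) \sw_(n0, n1 <- coact n)
         ((m0 ⊗ n0) ⊗ (m1 ⋆ n1)) |}.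

Definition yd_unit : yd_data :=
  {| ydobj := hunit k;
     act := fun t : k^o ⊗ H => \sw_(x, h <- t) (hcounit H h * x);
     coact := fun x : k^o => x ⊗ hone H |}.

Definition yd_tensm (M M' N N' : yd_data) (f : M -> M') (g : N -> N') :
    yd_tens M N -> yd_tens M' N' := tmap f g.

Definition yd_assc (M N P : yd_data) :
    yd_tens (yd_tens M N) P -> yd_tens M (yd_tens N P) :=
  fun t : (M ⊗ N) ⊗ P =>
    \sw_(x, p <- t) \sw_(m, n <- x) (aut M m ⊗ (n ⊗ autV P p)).

Definition yd_lunit (M : yd_data) : yd_tens yd_unit M -> M :=
  fun t : k^o ⊗ M => \sw_(x, m <- t) ((x : k) *: aut M m).

Definition yd_runit (M : yd_data) : yd_tens M yd_unit -> M :=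
  fun t : M ⊗ k^o => \sw_(m, x <- t) ((x : k) *: aut M m).

Definition yd_braid (M N : yd_data) : yd_tens M N -> yd_tens N M :=
  fun t : M ⊗ N =>
    \sw_(m, n <- t) \sw_(n0, n1 <- coact n) (aut N n0 ⊗ (autV M m ◁ n1)).

(* That these maps live in the category of Yetter-Drinfeld modules is not proved
   in this file: it is a claim, and monoidal_data is built from a proof of it. *)
Record yd_closed : Prop := YDClosed {
  yd_tens_closed : forall M N : yd, is_yd (yd_tens M N);
  yd_unit_closed : is_yd yd_unit;
  yd_tensm_closed : forall (M M' N N' : yd) (f : yd_hom M M') (g : yd_hom N N'),
    is_yd_mor (yd_tensm f g);
  yd_assc_closed : forall M N P : yd, is_yd_mor (@yd_assc M N P);
  yd_lunit_closed : forall M : yd, is_yd_mor (@yd_lunit M);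
  yd_runit_closed : forall M : yd, is_yd_mor (@yd_runit M);
  yd_braid_closed : forall M N : yd, is_yd_mor (@yd_braid M N)
}.

Definition yd_monoidal (w : yd_closed) : monoidal_data yd_cat :=
  @MonoidalData yd_cat
    (fun M N : yd => YD (yd_tens_closed w M N))
    (fun (M M' N N' : yd) f g => YDHom (yd_tensm_closed w f g))
    (YD (yd_unit_closed w))
    (fun M N P : yd => YDHom (yd_assc_closed w M N P))
    (fun M : yd => YDHom (yd_lunit_closed w M))
    (fun M : yd => YDHom (yd_runit_closed w M)).

Definition yd_prebraiding (w : yd_closed) (M N : yd_cat) :
    hom (tens (yd_monoidal w) M N) (tens (yd_monoidal w) N M) :=
  YDHom (yd_braid_closed w M N).

End YetterDrinfeld.

(* Main.v *)
From HB Require Import structures.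
Require Import Defs.
From mathcomp Require Import all_boot all_order all_algebra boolp.
Set Implicit Arguments.
Unset Strict Implicit.
Unset Printing Implicit Defensive.
Import GRing.Theory.
Local Open Scope ring_scope.

(* All the identities are multilinear, so they are checked on pure tensors, in
   Sweedler notation and with the structure automorphisms pushed to the leaves.
   The Yetter-Drinfeld condition is used three times: applied once to N and once
   to M it gives the condition for M ⊗ N; its two sides are the images of
   (m ⊗ n) ◁ h under the two orders of braiding and acting; and together with
   coassociativity it makes the braiding colinear.  The hexagons need only
   (co)associativity.  The inverse of an antipode S, if it exists, satisfies
   S^-1(h2) h1 = ε(h) 1 = h2 S^-1(h1) because S is antimultiplicative, and then
   n ⊗ m |-> μ^-1(m) ◁ S^-1(n1) ⊗ ν(n0) is inverse to the braiding. *)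

Local Notation "n ◁ h" := (ract n h) : ring_scope.

(** * Linearity of composites, scalings and Sweedler sums *)

Section Linearity.
Variable k : comPzRingType.
Implicit Types M N P Q : lmodType k.

Lemma linear_comp_fun M N P (f : N -> P) (g : M -> N) :
  linear f -> linear g -> linear (fun x => f (g x)).
Proof. by move=> lf lg a x y; rewrite lg lf. Qed.

Lemma bilinear_compl M N P Q (F : M -> N -> P) (g : Q -> M) n :
  is_bilinear F -> linear g -> linear (fun x => F (g x) n).
Proof. by move=> [_ lF] lg a x y; rewrite lg lF. Qed.

Lemma bilinear_compr M N P Q (F : M -> N -> P) (g : Q -> N) m :
  is_bilinear F -> linear g -> linear (fun x => F m (g x)).
Proof. by move=> [lF _] lg a x y; rewrite lg lF. Qed.

(** The tensor [t] is fixed, so the same expression of it serves every [x] and linearity is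
    inherited term by term. *)
Lemma linear_sw_body M N P Q (t : M ⊗ N) (F : Q -> M -> N -> P) :
  (forall m n, linear (fun x => F x m n)) -> linear (fun x => sweedler t (F x)).
Proof.
move=> lF a x y; rewrite /sweedler scaler_sumr -big_split.
by apply: eq_bigr => p _; rewrite lF.
Qed.

(** Here the tensor varies with [x], and so does its chosen expression; bilinearity of [F] makes the
    sum independent of that choice. *)
Lemma linear_sw_arg M N P Q (F : M -> N -> P) (g : Q -> M ⊗ N) :
  linear g -> is_bilinear F -> linear (fun x => sweedler (g x) F).
Proof. by move=> lg bF a x y; rewrite lg (sweedler_linear bF). Qed.

Lemma linear_scalel M Q (f : Q -> k^o) (m : M) :
  linear f -> linear (fun x => (f x : k) *: m).
Proof. by move=> lf c x y; rewrite lf scalerDl scalerA. Qed.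

Lemma linear_scaler (a : k) M Q (f : Q -> M) :
  linear f -> linear (fun x => a *: f x).
Proof. by move=> lf c x y; rewrite lf scalerDr !scalerA mulrC. Qed.

Lemma linear_mull (a : k) M (f : M -> k^o) :
  linear f -> linear (fun x => a * (f x : k) : k^o).
Proof. by move=> lf c x y; rewrite lf mulrDr /GRing.scale /= mulrCA. Qed.

Lemma linear_mulr (a : k) M (f : M -> k^o) :
  linear f -> linear (fun x => (f x : k) * a : k^o).
Proof. by move=> lf c x y; rewrite lf mulrDl /GRing.scale /= mulrA. Qed.

Lemma linear_scale M P (f : M -> P) (a : k) m : linear f -> f (a *: m) = a *: f m.
Proof.
(* Most structure maps are bare functions accompanied by a proof of linearity; packing one as a
   linear map gives access to the algebra of linear maps. *)
move=> lf; pose f' := HB.pack f (GRing.isLinear.Build _ _ _ _ f lf) : {linear M -> P}.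
exact: (linearZ_LR f').
Qed.

Lemma linear_sw M N P Q (f : P -> Q) (t : M ⊗ N) (G : M -> N -> P) :
  linear f -> f (sweedler t G) = \sw_(m, n <- t) f (G m n).
Proof.
move=> lf; pose f' := HB.pack f (GRing.isLinear.Build _ _ _ _ f lf) : {linear P -> Q}.
exact: (raddf_sum f').
Qed.

Lemma sw_sw M N P Q (U : lmodType k) (t : M ⊗ N) (G : M -> N -> P ⊗ Q) (F : P -> Q -> U) :
  is_bilinear F ->
  sweedler (sweedler t G) F = \sw_(m, n <- t) sweedler (G m n) F.
Proof. by move=> bF; rewrite (linear_sw (f := sweedler^~ F)) //; apply: sweedler_linear. Qed.

Lemma sw_eta M N (t : M ⊗ N) : t = \sw_(m, n <- t) (m ⊗ n).
Proof. exact: tensor_sum_pure. Qed.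

Lemma eq_sw M N (P : nmodType) (t : M ⊗ N) (F G : M -> N -> P) :
  (forall m n, F m n = G m n) -> sweedler t F = sweedler t G.
Proof. by move=> FG; apply: eq_bigr => p _. Qed.

Lemma sw_exchange M N P Q (U : nmodType) (t : M ⊗ N) (s : P ⊗ Q) (F : M -> N -> P -> Q -> U) :
  \sw_(m, n <- t) \sw_(p, q <- s) F m n p q
    = \sw_(p, q <- s) \sw_(m, n <- t) F m n p q.
Proof. exact: exchange_big. Qed.

Lemma linear_hcounit (H : mhbialg k) M (g : M -> H) :
  linear g -> linear (fun x => hcounit H (g x)).
Proof. by move=> lg a x y; rewrite lg linearP. Qed.

End Linearity.

(* Automation for linearity and bilinearity goals *)
Create HintDb lin.
#[local] Hint Extern 0 =>
  match goal with |- context [@pure] => exact: pure_bilinear end : lin.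
#[local] Hint Extern 0 =>
  match goal with |- context [@hmul] => exact: hmul_bilinear end : lin.

(** The patterns of [mlin] expect an explicit abstraction, so any other function is eta-expanded
    first. *)
Ltac lin_eta :=
  lazymatch goal with
  | |- GRing.linear_for _ (fun _ => _) => idtac
  | |- GRing.linear_for ?s ?f => change (GRing.linear_for s (fun x => f x))
  end.

Ltac lin_head := first [assumption | exact: linearP | solve [auto 2 with lin nocore]].

(* Proves linearity and bilinearity by recursion on the body of the function.
   The inner match must backtrack: under a binder, the metavariables ?f and ?n
   can also capture subterms that mention the bound variable. *)
Ltac mlin :=
  cbv beta;
  lazymatch goal with
  | |- is_bilinear _ =>
     first [assumption | solve [auto 2 with lin nocore] | split=> ?; mlin]
  | |- forall _, _ => move=> ?; mlin
  | |- _ =>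
  lin_eta;
  match goal with
  | |- GRing.linear_for _ (fun x => x) => by move=> ? ? ?
  | |- GRing.linear_for _ (fun x => sweedler (@?g x) ?F) =>
      apply: (@linear_sw_arg _ _ _ _ _ F g); mlin
  | |- GRing.linear_for _ (fun x => sweedler ?t (@?F x)) =>
      apply: (@linear_sw_body _ _ _ _ _ t F); mlin
  | |- GRing.linear_for _ (fun x => ?a * (@?f x)) =>
      apply: (@linear_mull _ a _ f); mlin
  | |- GRing.linear_for _ (fun x => (@?f x) * ?a) =>
      apply: (@linear_mulr _ a _ f); mlin
  | |- GRing.linear_for _ (fun x => GRing.scale (@?g x) ?n) =>
      apply: (@linear_scalel _ _ _ g n); mlin
  | |- GRing.linear_for _ (fun x => GRing.scale ?m (@?g x)) =>
      apply: (@linear_scaler _ m _ _ g); mlin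
  | |- GRing.linear_for _ (fun x => GRing.Linear.sort (hcounit ?H) (@?g x)) =>
      apply: (@linear_hcounit _ H _ g); mlin
  | |- GRing.linear_for _ (fun x => ?f (@?g x)) =>
      first [ apply: (@linear_comp_fun _ _ _ _ f g); [lin_head | mlin]
            | lazymatch f with ?F ?m => apply: (@bilinear_compr _ _ _ _ _ F g m); mlin end]
  | |- GRing.linear_for _ (fun x => ?F (@?g x) ?n) =>
      apply: (@bilinear_compl _ _ _ _ _ F g n); mlin
  | |- GRing.linear_for _ (fun x => ?F (@?g x) ?n ?p) =>
      apply: (@linear_comp_fun _ _ _ _ (fun z => F z n p) g); [lin_head | mlin]
  end
  end.

(* With these two hints a trailing [//] settles the side conditions of the Sweedler rewriting
   lemmas. *)
#[local] Hint Extern 0 (is_bilinear _) => mlin : core.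
#[local] Hint Extern 0 (GRing.linear_for _ _) => mlin : core.

(** * Sweedler calculus in a monoidal Hom-bialgebra *)

Section HopfCalculus.
Variables (k : comPzRingType) (H : mhbialg k).
Implicit Types (M N P : lmodType k) (c h g : H).

Lemma autV_hmul g h : autV H (g ⋆ h) = autV H g ⋆ autV H h.
Proof. by apply: (can_inj (@autK k H)); rewrite aut_hmul !autVK. Qed.

Lemma autV_hone : autV H (hone H) = hone H.
Proof. by rewrite -{1}(aut_hone H) autK. Qed.

Lemma hcounit_autV h : hcounit H (autV H h) = hcounit H h.
Proof. by rewrite -(hcounit_aut (autV H h)) autVK. Qed.

(** Hom-associativity taken at [autV H c], so that it rewrites any left-bracketed product. *)
Lemma hmulA_autV g h c : (g ⋆ h) ⋆ c = aut H g ⋆ (h ⋆ autV H c).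
Proof. by rewrite hmulA autVK. Qed.

Lemma sw_comul_aut N c (F : H -> H -> N) : is_bilinear F ->
  sweedler (hcomul H (aut H c)) F = \sw_(a, b <- hcomul H c) F (aut H a) (aut H b).
Proof.
move=> bF; rewrite hcomul_aut sw_sw //.
by apply: eq_sw => a b; rewrite sweedler_pure.
Qed.

Lemma sw_comul_autV N c (F : H -> H -> N) : is_bilinear F ->
  sweedler (hcomul H (autV H c)) F = \sw_(a, b <- hcomul H c) F (autV H a) (autV H b).
Proof.
move=> bF; rewrite -{2}(autVK c) sw_comul_aut //.
by apply: eq_sw => a b; rewrite !autK.
Qed.

Lemma sw_comulM N g h (F : H -> H -> N) : is_bilinear F ->
  sweedler (hcomul H (g ⋆ h)) F
  = \sw_(g1, g2 <- hcomul H g) \sw_(h1, h2 <- hcomul H h) F (g1 ⋆ h1) (g2 ⋆ h2).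
Proof.
move=> bF; rewrite hcomulM sw_sw //; apply: eq_sw => a b.
by rewrite sw_sw //; apply: eq_sw => x y; rewrite sweedler_pure.
Qed.

Lemma sw_comul1 N (F : H -> H -> N) : is_bilinear F ->
  sweedler (hcomul H (hone H)) F = F (hone H) (hone H).
Proof. by move=> bF; rewrite hcomul1 sweedler_pure. Qed.

Lemma sw_counitr N c (f : H -> N) : linear f ->
  \sw_(a, b <- hcomul H c) (hcounit H b *: f a) = f (autV H c).
Proof.
move=> lf; rewrite -hcounitr (linear_sw (f := f)) //; apply: eq_sw => a b.
by rewrite linear_scale.
Qed.

Lemma sw_counitl N c (f : H -> N) : linear f ->
  \sw_(a, b <- hcomul H c) (hcounit H a *: f b) = f (autV H c).
Proof.
move=> lf; rewrite -hcounitl (linear_sw (f := f)) //; apply: eq_sw => a b.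
by rewrite linear_scale.
Qed.

(** The linear map $a\otimes(x\otimes y)\mapsto F(\alpha(a),x,y)$ is applied to both sides of
    [hcomulA]. In this form coassociativity rebrackets triple Sweedler sums with a trilinear
    body. *)
Lemma sw_comulA N c (F : H -> H -> H -> N) :
  (forall h, is_bilinear (F h)) -> (forall g h, linear (fun x => F x g h)) ->
  \sw_(a, b <- hcomul H c) \sw_(x, y <- hcomul H b) F a x y
  = \sw_(a, b <- hcomul H c) \sw_(x, y <- hcomul H a) F (aut H x) y (autV H b).
Proof.
move=> bF lF; have := congr1 (fun t => \sw_(a, u <- t) \sw_(x, y <- u) F (aut H a) x y) (hcomulA c).
rewrite !sw_sw //.
under eq_sw => a b do rewrite sweedler_pure // autVK.
move=> ->; apply: eq_sw => a b; rewrite sw_sw //; apply: eq_sw => x y.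
by rewrite !sweedler_pure.
Qed.

End HopfCalculus.

(** * Linearity of the action and the coaction *)

Section StructureMaps.
Variables (k : comPzRingType) (H : mhbialg k).
Implicit Types (M N : yd H) (h g : H).

Lemma act_linear N : linear (@act k H N).
Proof. by have [[[]]] := ydP N. Qed.

Lemma coact_linear N : linear (@coact k H N).
Proof. by have [_ [[]]] := ydP N. Qed.

Lemma ract_bilinear N : is_bilinear (@ract k H N).
Proof.
have lN := @act_linear N; split=> [n|h] a x y; rewrite /ract -lN; congr act;
  [exact: (pure_bilinear _ _).1 | exact: (pure_bilinear _ _).2].
Qed.

End StructureMaps.

#[local] Hint Extern 0 =>
  match goal with |- context [@act] => exact: act_linear end : lin.
#[local] Hint Extern 0 =>
  match goal with |- context [@coact] => exact: coact_linear end : lin.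
#[local] Hint Extern 0 =>
  match goal with |- context [@ract] => exact: ract_bilinear end : lin.

(** * Sweedler calculus in a Yetter-Drinfeld module *)

Section YetterDrinfeldCalculus.
Variables (k : comPzRingType) (H : mhbialg k).
Implicit Types (M N : yd H) (P : lmodType k) (h g : H).

Lemma aut_ract N (n : N) h : aut N (n ◁ h) = aut N n ◁ aut H h.
Proof.
by have [[[_ aN] _ _] _ _] := ydP N; rewrite /ract aN /= /tmap sweedler_pure.
Qed.

Lemma autV_ract N (n : N) h : autV N (n ◁ h) = autV N n ◁ autV H h.
Proof. by apply: (can_inj (@autK k N)); rewrite aut_ract !autVK. Qed.

Lemma ract_ract N (n : N) g h : (n ◁ g) ◁ h = aut N n ◁ (g ⋆ autV H h).
Proof. by have [[_ rA _] _ _] := ydP N; rewrite -rA autVK. Qed.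

Lemma ract_hone N (n : N) : n ◁ hone H = aut N n.
Proof. by have [[_ _ r1] _ _] := ydP N. Qed.

Lemma sw_coact_aut N P (n : N) (F : N -> H -> P) : is_bilinear F ->
  sweedler (coact (aut N n)) F = \sw_(x, y <- coact n) F (aut N x) (aut H y).
Proof.
move=> bF; have -> : coact (aut N n) = \sw_(x, y <- coact n) (aut N x ⊗ aut H y).
  by have [_ [[_ aN] _ _] _] := ydP N; rewrite -aN.
by rewrite sw_sw //; apply: eq_sw => x y; rewrite sweedler_pure.
Qed.

Lemma sw_coact_autV N P (n : N) (F : N -> H -> P) : is_bilinear F ->
  sweedler (coact (autV N n)) F = \sw_(x, y <- coact n) F (autV N x) (autV H y).
Proof.
move=> bF; rewrite -{2}(autVK n) sw_coact_aut //.
by apply: eq_sw => x y; rewrite !autK.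
Qed.

(** The linear map $x\otimes(g\otimes h)\mapsto F(x,g,\alpha(h))$ is applied to both sides of
    [coactA]; this trades an iterated coaction for a comultiplication of the [H]-leg. *)
Lemma sw_coactA N P (n : N) (F : N -> H -> H -> P) :
  (forall x, is_bilinear (F x)) -> (forall g h, linear (fun x => F x g h)) ->
  \sw_(x, y <- coact n) \sw_(z, w <- coact x) F z w y
  = \sw_(x, y <- coact n) \sw_(g, h <- hcomul H y) F (autV N x) g (aut H h).
Proof.
move=> bF lF; have [_ [_ /(_ n) cA _] _] := ydP N.
have := congr1 (fun t => \sw_(x, u <- t) \sw_(g, h <- u) F x g (aut H h)) cA.
rewrite !sw_sw //.
under eq_sw => a b do rewrite sweedler_pure //.
move=> ->; apply: eq_sw => a b; rewrite sw_sw //; apply: eq_sw => x y.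
by rewrite !sweedler_pure // autVK.
Qed.

Lemma sw_coact_counit N P (n : N) (f : N -> P) : linear f ->
  \sw_(x, y <- coact n) (hcounit H y *: f x) = f (autV N n).
Proof.
move=> lf; have [_ [_ _ /(_ n) <-] _] := ydP N.
by rewrite (linear_sw (f := f)) //; apply: eq_sw => a b; rewrite linear_scale.
Qed.

(** Composing the Yetter-Drinfeld condition with an arbitrary bilinear [F] allows its use inside
    larger sums. *)
Lemma sw_yd N P (n : N) h (F : N -> H -> P) : is_bilinear F ->
  \sw_(x, y <- coact n) \sw_(a, b <- hcomul H h) F (x ◁ autV H a) (y ⋆ autV H b)
  = \sw_(a, b <- hcomul H h) \sw_(x, y <- coact (n ◁ b)) F x (autV H (a ⋆ y)).
Proof.
move=> bF; have [_ _ /(_ h n)/(congr1 (sweedler^~ F))] := ydP N.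
rewrite !sw_sw //.
under eq_sw => x y.
  rewrite sw_sw //; under eq_sw => a b do rewrite sweedler_pure //.
  over.
move=> ->; apply: eq_sw => a b; rewrite sw_sw //; apply: eq_sw => x y.
by rewrite sweedler_pure.
Qed.

End YetterDrinfeldCalculus.

(** Reduces an equation whose two sides are linear in [t] to pure tensors; [mlin] supplies both
    linearity proofs. *)
Ltac pure_ext t :=
  move: t;
  lazymatch goal with
  | |- forall t, @eq _ (@?f t) (@?g t) =>
      apply: (tensor_ext (f := f) (g := g)); [mlin | mlin | cbv beta]
  end.

(** * The tensor product of two Yetter-Drinfeld modules *)

Section Tensor.
Variables (k : comPzRingType) (H : mhbialg k).
Implicit Types (M N : yd H) (P : lmodType k) (h g : H).

Lemma tens_ractE M N (m : M) (n : N) h :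
  @ract _ _ (yd_tens M N) (m ⊗ n) h = \sw_(a, b <- hcomul H h) ((m ◁ a) ⊗ (n ◁ b)).
Proof. by rewrite /ract /= sweedler_pure // sweedler_pure. Qed.

Lemma tens_coactE M N (m : M) (n : N) :
  @coact _ _ (yd_tens M N) (m ⊗ n)
  = \sw_(x, a <- coact m) \sw_(y, b <- coact n) ((x ⊗ y) ⊗ (a ⋆ b)).
Proof. by rewrite /= sweedler_pure. Qed.

Lemma tens_act_linear M N : linear (@act k H (yd_tens M N)).
Proof. by rewrite /=; mlin. Qed.

Lemma tens_coact_linear M N : linear (@coact k H (yd_tens M N)).
Proof. by rewrite /=; mlin. Qed.

Lemma tens_ract_bilinear M N : is_bilinear (@ract k H (yd_tens M N)).
Proof.
have lN := @tens_act_linear M N; split=> [n|h] a x y; rewrite /ract -lN; congr act;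
  [exact: (pure_bilinear _ _).1 | exact: (pure_bilinear _ _).2].
Qed.

#[local] Hint Extern 0 =>
  match goal with |- context [@act] => exact: tens_act_linear end : lin.
#[local] Hint Extern 0 =>
  match goal with |- context [@coact] => exact: tens_coact_linear end : lin.
#[local] Hint Extern 0 =>
  match goal with |- context [@ract] => exact: tens_ract_bilinear end : lin.

Lemma aut_tens (M N : hobj k) (m : M) (n : N) : aut (htens M N) (m ⊗ n) = aut M m ⊗ aut N n.
Proof. by rewrite /= /tmap sweedler_pure. Qed.

Lemma autV_tens (M N : hobj k) (m : M) (n : N) :
  autV (htens M N) (m ⊗ n) = autV M m ⊗ autV N n.
Proof. by rewrite /= /tmap sweedler_pure. Qed.

Lemma tens_ract_sw M N (P Q : lmodType k) (t : P ⊗ Q) (G : P -> Q -> M ⊗ N) h :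
  @ract _ _ (yd_tens M N) (sweedler t G) h = \sw_(p, q <- t) @ract _ _ (yd_tens M N) (G p q) h.
Proof.
apply: (linear_sw (f := fun x => @ract _ _ (yd_tens M N) x h)).
by have [] := tens_ract_bilinear M N.
Qed.

(** Associativity of the action comes from multiplicativity of the comultiplication, and the unit
    law from [hcomul1]. *)
Lemma tens_module M N : is_hom_module (yd_tens M N).
Proof.
split.
- split; first exact: tens_act_linear.
  change (forall t : (M ⊗ N) ⊗ H, aut (yd_tens M N) (@act k H (yd_tens M N) t)
     = @act k H (yd_tens M N) (aut (htens (yd_tens M N) H) t)).
  move=> t; pure_ext t => t h; pure_ext t => m n.
  rewrite -/(ract _ _) tens_ractE !aut_tens -/(ract _ _) tens_ractE.
  rewrite (linear_sw (f := aut _)) // sw_comul_aut //; apply: eq_sw => a b.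
  by rewrite aut_tens !aut_ract.
- move=> t g h. pure_ext t => m n.
  rewrite aut_tens !tens_ractE sw_comulM // tens_ract_sw; apply: eq_sw => a b.
  rewrite tens_ractE sw_comul_aut //; apply: eq_sw => c d.
  by rewrite !ract_ract !autK.
- move=> t; pure_ext t => m n. by rewrite tens_ractE sw_comul1 // aut_tens !ract_hone.
Qed.

Lemma tens_comodule M N : is_hom_comodule (yd_tens M N).
Proof.
split.
- split; first exact: tens_coact_linear.
  change (forall t : M ⊗ N, aut (htens (yd_tens M N) H) (@coact k H (yd_tens M N) t)
     = @coact k H (yd_tens M N) (aut (yd_tens M N) t)).
  move=> t; pure_ext t => m n.
  rewrite aut_tens !tens_coactE sw_coact_aut // (linear_sw (f := aut _)) //.
  apply: eq_sw => x a; rewrite sw_coact_aut // (linear_sw (f := aut _)) //.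
  apply: eq_sw => y b.
  by rewrite !aut_tens aut_hmul.
- move=> t; pure_ext t => m n.
  rewrite tens_coactE !sw_sw //.
  (* In this middle form the coaction is iterated on [m], while the [H]-leg of [n] is still
     comultiplied: coassociativity of [M] gives the first half, that of [N] the second. *)
  transitivity (\sw_(x, a <- coact m) \sw_(x', a' <- coact x)
    \sw_(y, b <- coact n) \sw_(b1, b2 <- hcomul H b)
      ((x' ⊗ autV N y) ⊗ ((a' ⋆ b1) ⊗ (autV H a ⋆ b2)))).
    rewrite sw_coactA //; apply: eq_sw => x a; rewrite sw_sw // sw_exchange.
    apply: eq_sw => y b; rewrite sweedler_pure // autV_tens hcomulM.
    rewrite (linear_sw (f := pure _)) //; apply: eq_sw => a1 a2.
    rewrite (linear_sw (f := pure _)) //; apply: eq_sw => b1 b2.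
    by rewrite autK.
  apply: eq_sw => x a; rewrite sw_sw //.
  under [RHS]eq_sw => y b do rewrite sweedler_pure // tens_coactE sw_sw //.
  rewrite [RHS]sw_exchange; apply: eq_sw => x' a'.
  under [RHS]eq_sw => y b.
    rewrite sw_sw //; under eq_sw => y' b' do rewrite sweedler_pure //.
    over.
  rewrite [RHS]sw_coactA //.
  by apply: eq_sw => y b; apply: eq_sw => b1 b2; rewrite autV_hmul autK.
- move=> t; pure_ext t => m n.
  rewrite tens_coactE autV_tens sw_sw //.
  (* Multiplicativity of the counit splits the sum, so the counit laws of [M] and [N] apply one
     after the other. *)
  rewrite -[RHS](sw_coact_counit m (f := fun x => x ⊗ autV N n)) //.
  apply: eq_sw => x a.
  rewrite sw_sw //.
  rewrite -[RHS](sw_coact_counit n (f := fun y => hcounit H a *: (x ⊗ y : htens M N))) //.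
  by apply: eq_sw => y b; rewrite sweedler_pure // hcounitM mulrC -scalerA.
Qed.

Lemma tens_yd M N : yd_compatible (yd_tens M N).
Proof.
move=> h t. pure_ext t => m n.
rewrite tens_coactE sw_sw //.
(* The form reached once the condition has been applied to [n] and then to [m], with the legs of [h]
   rebracketed in between. The right-hand side then follows by coassociativity and
   Hom-associativity. *)
transitivity (\sw_(a, b <- hcomul H h) \sw_(a1, a2 <- hcomul H a)
   \sw_(x, z <- coact (m ◁ a2)) \sw_(y, w <- coact (n ◁ autV H b))
     ((x ⊗ y) ⊗ (autV H (a1 ⋆ z) ⋆ w))).
  transitivity (\sw_(x, z <- coact m) \sw_(a, b <- hcomul H h) \sw_(b1, b2 <- hcomul H b)
    \sw_(y, w <- coact (n ◁ b2))
     ((x ◁ autV H (autV H a) ⊗ y) ⊗ ((z ⋆ autV H b1) ⋆ w))).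
    apply: eq_sw => x z; rewrite sw_sw //.
    transitivity (\sw_(y, w <- coact n) \sw_(a, b <- hcomul H h) \sw_(b1, b2 <- hcomul H b)
      ((x ◁ autV H (autV H a) ⊗ (y ◁ autV H b1)) ⊗ (aut H z ⋆ (w ⋆ autV H b2)))).
      apply: eq_sw => y w; rewrite sweedler_pure // sw_comulA //; apply: eq_sw => a b.
      rewrite tens_ractE sw_comul_autV // (linear_sw (f := pure^~ _)) //.
      by apply: eq_sw => a1 a2; rewrite autK hmulA_autV.
    rewrite sw_exchange; apply: eq_sw => a b.
    (* The condition for [N] at the second leg [b] of [h]; the factor [z] coming from [m] is carried
       along in [F]. *)
    rewrite (sw_yd n b (F := fun y w => (_ ⊗ y) ⊗ (aut H z ⋆ w))) //.
    apply: eq_sw => b1 b2; apply: eq_sw => y w.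
    by rewrite autV_hmul hmulA autVK.
  rewrite sw_exchange.
  under eq_sw => a b do rewrite sw_exchange.
  rewrite sw_comulA //.
  apply: eq_sw => a b; rewrite sw_exchange.
  (* The condition for [M] at the first leg [a]; the whole coaction on the [n] side is absorbed into
     [F]. *)
  rewrite -(sw_yd m a (F := fun x z =>
    \sw_(y, w <- coact (n ◁ autV H b)) ((x ⊗ y) ⊗ (z ⋆ w)))) //.
  by apply: eq_sw => x z; apply: eq_sw => a1 a2; rewrite autK.
transitivity (\sw_(a, b <- hcomul H h) \sw_(b1, b2 <- hcomul H b)
  \sw_(x, z <- coact (m ◁ b1)) \sw_(y, w <- coact (n ◁ b2))
     ((x ⊗ y) ⊗ autV H (a ⋆ (z ⋆ w)))); last first.
  apply: eq_sw => a b; rewrite tens_ractE (linear_sw (f := @coact _ _ (yd_tens M N))) // sw_sw //.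
  apply: eq_sw => b1 b2; rewrite tens_coactE sw_sw //.
  apply: eq_sw => x z; rewrite sw_sw //; apply: eq_sw => y w.
  by rewrite sweedler_pure.
rewrite sw_comulA //; apply: eq_sw => a b; apply: eq_sw => a1 a2.
apply: eq_sw => x z; apply: eq_sw => y w.
by rewrite hmulA !autV_hmul autK.
Qed.

Lemma tens_closed M N : is_yd (yd_tens M N).
Proof. by split; [apply: tens_module | apply: tens_comodule | apply: tens_yd]. Qed.

End Tensor.

(* Makes the lemmas about an object N : yd H apply to yd_tens M N as well. *)
#[local] Canonical tens_ydobj (k : comPzRingType) (H : mhbialg k) (M N : yd H) : yd H :=
  YD (tens_closed M N).

(** * The unit object *)

Section Unit.
Variables (k : comPzRingType) (H : mhbialg k).
Implicit Types (M N P : yd H) (h g : H).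

Lemma pureZl (V W : lmodType k) (a : k) (v : V) (w : W) : (a *: v) ⊗ w = a *: (v ⊗ w).
Proof. by rewrite (linear_scale (f := pure^~ w)). Qed.

Lemma pureZr (V W : lmodType k) (a : k) (v : V) (w : W) : v ⊗ (a *: w) = a *: (v ⊗ w).
Proof. by rewrite (linear_scale (f := pure v)). Qed.

Lemma unit_ractE (x : yd_unit H) h :
  @ract _ _ (yd_unit H) x h = (hcounit H h : k) * (x : k) :> k.
Proof. by rewrite /ract /= sweedler_pure. Qed.

Lemma unit_coactE (x : yd_unit H) : @coact _ _ (yd_unit H) x = x ⊗ hone H.
Proof. by []. Qed.

Lemma unit_act_linear : linear (@act k H (yd_unit H)).
Proof. by rewrite /=; mlin. Qed.

Lemma unit_ract_bilinear : is_bilinear (@ract k H (yd_unit H)).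
Proof.
have lu := unit_act_linear; split=> [n|h] a x y; rewrite /ract -lu; congr act;
  [exact: (pure_bilinear _ _).1 | exact: (pure_bilinear _ _).2].
Qed.

Lemma unit_module : is_hom_module (yd_unit H).
Proof.
split.
- split; first exact: unit_act_linear.
  change (forall t : k^o ⊗ H, @act k H (yd_unit H) t
     = @act k H (yd_unit H) (aut (htens (yd_unit H) H) t)).
  move=> t; have lu := unit_act_linear; pure_ext t => x h.
  rewrite aut_tens; change (@ract k H (yd_unit H) x h = @ract k H (yd_unit H) x (aut H h)).
  by rewrite !unit_ractE hcounit_aut.
- by move=> x g h; rewrite !unit_ractE hcounit_aut hcounitM mulrA [_ * hcounit H g]mulrC.
- by move=> x; rewrite unit_ractE hcounit1 mul1r.
Qed.

Lemma unit_comodule : is_hom_comodule (yd_unit H).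
Proof.
split.
- split=> [|x]; first by rewrite /=; mlin.
  by rewrite aut_tens aut_hone.
- by move=> x; rewrite /= !sweedler_pure // hcomul1 autV_hone.
- by move=> x; rewrite /= sweedler_pure // hcounit1 scale1r.
Qed.

(** The two sides both collapse to [x ⊗ autV H h], one by the left counit axiom and the other by the
    right one. *)
Lemma unit_yd : yd_compatible (yd_unit H).
Proof.
move=> h x; have bu := unit_ract_bilinear.
rewrite unit_coactE sweedler_pure //.
transitivity ((x : yd_unit H) ⊗ autV H h).
  rewrite -(sw_counitl h (f := pure (x : yd_unit H))) //; apply: eq_sw => a b.
  by rewrite unit_ractE hcounit_autV hmul1r autVK -pureZl.
rewrite -(sw_counitr h (f := pure (x : yd_unit H))) //; apply: eq_sw => a b.
by rewrite unit_coactE sweedler_pure // hmulr1 autK unit_ractE -pureZl.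
Qed.

Lemma unit_closed : is_yd (yd_unit H).
Proof. by split; [apply: unit_module | apply: unit_comodule | apply: unit_yd]. Qed.

End Unit.

#[local] Canonical unit_ydobj (k : comPzRingType) (H : mhbialg k) : yd H :=
  YD (unit_closed H).

(** * Morphisms, and the structure maps on pure tensors *)

Section Morphisms.
Variables (k : comPzRingType) (H : mhbialg k).
Implicit Types (M N P Q : yd H) (h g : H).

Lemma yd_hom_linear (M N : yd_data H) (f : yd_hom M N) : linear f.
Proof. by case: f => f [[]]. Qed.

#[local] Hint Extern 0 =>
  match goal with |- context [@yd_fun] => exact: yd_hom_linear end : lin.

Lemma yd_hom_aut (M N : yd_data H) (f : yd_hom M N) m : f (aut M m) = aut N (f m).
Proof. by case: f => f [[]]. Qed.

Lemma yd_hom_autV (M N : yd_data H) (f : yd_hom M N) m : f (autV M m) = autV N (f m).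
Proof. by apply: (can_inj (@autK k N)); rewrite -yd_hom_aut !autVK. Qed.

Lemma yd_hom_ract (M N : yd_data H) (f : yd_hom M N) m h : f (m ◁ h) = f m ◁ h.
Proof. by case: f => f []. Qed.

Lemma sw_coact_hom M N (P : lmodType k) (f : yd_hom M N) m (F : N -> H -> P) : is_bilinear F ->
  sweedler (coact (f m)) F = \sw_(x, y <- coact m) F (f x) y.
Proof.
move=> bF; have [_ _ ->] := yd_homP f.
by rewrite sw_sw //; apply: eq_sw => x y; rewrite sweedler_pure.
Qed.

Lemma ract_sw M (P Q : lmodType k) (t : P ⊗ Q) (G : P -> Q -> M) h :
  sweedler t G ◁ h = \sw_(p, q <- t) (G p q ◁ h).
Proof. by apply: (linear_sw (f := fun x => x ◁ h)). Qed.

Lemma sw_coact_tens M N (P : lmodType k) (m : M) (n : N) (F : M ⊗ N -> H -> P) : is_bilinear F ->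
  sweedler (@coact k H (yd_tens M N) (m ⊗ n)) F
  = \sw_(x, a <- coact m) \sw_(y, b <- coact n) F (x ⊗ y) (a ⋆ b).
Proof.
move=> bF; rewrite tens_coactE sw_sw //; apply: eq_sw => x a.
by rewrite sw_sw //; apply: eq_sw => y b; rewrite sweedler_pure.
Qed.

Lemma yd_tensmE (M M' N N' : yd_data H) (f : M -> M') (g : N -> N') m n :
  linear f -> linear g -> yd_tensm f g (m ⊗ n) = f m ⊗ g n.
Proof. by move=> lf lg; rewrite /yd_tensm /tmap sweedler_pure. Qed.

Lemma yd_tensm_linear (M M' N N' : yd_data H) (f : M -> M') (g : N -> N') :
  linear f -> linear g -> linear (yd_tensm f g).
Proof. by move=> lf lg; rewrite /yd_tensm /tmap; mlin. Qed.

Lemma tensm_closed M M' N N' (f : yd_hom M M') (g : yd_hom N N') :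
  is_yd_mor (yd_tensm f g).
Proof.
have lfg := yd_tensm_linear (yd_hom_linear f) (yd_hom_linear g).
split.
- split=> // t; pure_ext t => m n.
  by rewrite aut_tens !yd_tensmE // aut_tens !yd_hom_aut.
- move=> t h; pure_ext t => m n.
  rewrite yd_tensmE // !tens_ractE (linear_sw (f := yd_tensm f g)) //; apply: eq_sw => a b.
  by rewrite yd_tensmE // !yd_hom_ract.
- move=> t; pure_ext t => m n.
  rewrite yd_tensmE // tens_coactE sw_coact_tens // sw_coact_hom //; apply: eq_sw => x a.
  by rewrite sw_coact_hom //; apply: eq_sw => y b; rewrite yd_tensmE.
Qed.

Lemma yd_asscE M N P m n p :
  @yd_assc k H M N P ((m ⊗ n) ⊗ p) = aut M m ⊗ (n ⊗ autV P p).
Proof. by rewrite /yd_assc !sweedler_pure. Qed.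

Lemma yd_assc_linear M N P : linear (@yd_assc k H M N P).
Proof. by rewrite /yd_assc; mlin. Qed.

Lemma yd_lunitE M (x : yd_unit H) m : @yd_lunit k H M (x ⊗ m) = (x : k) *: aut M m.
Proof. by rewrite /yd_lunit !sweedler_pure. Qed.

Lemma yd_lunit_linear M : linear (@yd_lunit k H M).
Proof. by rewrite /yd_lunit; mlin. Qed.

Lemma yd_runitE M (x : yd_unit H) m : @yd_runit k H M (m ⊗ x) = (x : k) *: aut M m.
Proof. by rewrite /yd_runit !sweedler_pure. Qed.

Lemma yd_runit_linear M : linear (@yd_runit k H M).
Proof. by rewrite /yd_runit; mlin. Qed.

Lemma yd_braidE M N m n :
  @yd_braid k H M N (m ⊗ n) = \sw_(x, y <- coact n) (aut N x ⊗ (autV M m ◁ y)).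
Proof. by rewrite /yd_braid !sweedler_pure. Qed.

Lemma yd_braid_linear M N : linear (@yd_braid k H M N).
Proof. by rewrite /yd_braid; mlin. Qed.

End Morphisms.

#[local] Hint Extern 0 =>
  match goal with |- context [@yd_fun] => exact: yd_hom_linear end : lin.
#[local] Hint Extern 0 =>
  match goal with |- context [@yd_tensm] => apply: yd_tensm_linear; mlin end : lin.
#[local] Hint Extern 0 =>
  match goal with |- context [@yd_assc] => exact: yd_assc_linear end : lin.
#[local] Hint Extern 0 =>
  match goal with |- context [@yd_lunit] => exact: yd_lunit_linear end : lin.
#[local] Hint Extern 0 =>
  match goal with |- context [@yd_runit] => exact: yd_runit_linear end : lin.
#[local] Hint Extern 0 =>
  match goal with |- context [@yd_braid] => exact: yd_braid_linear end : lin.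

(** * The constraints and the prebraiding as morphisms *)

Section Closure.
Variables (k : comPzRingType) (H : mhbialg k).
Implicit Types (M N P Q : yd H) (h g : H).

(** [H]-linearity amounts to coassociativity of the comultiplication, and colinearity to
    Hom-associativity of the product. *)
Lemma assc_closed M N P : is_yd_mor (@yd_assc k H M N P).
Proof.
split.
- split=> [|t]; first exact: yd_assc_linear.
  pure_ext t => t p; pure_ext t => m n.
  by rewrite !(aut_tens, yd_asscE) autK autVK.
- move=> t h; pure_ext t => t p; pure_ext t => m n.
  rewrite yd_asscE !tens_ractE (linear_sw (f := @yd_assc k H M N P)) //.
  under [RHS]eq_sw => a b do rewrite tens_ractE (linear_sw (f := pure _)) //.
  rewrite sw_comulA //; apply: eq_sw => a b.
  rewrite tens_ractE (linear_sw (f := pure^~ (p ◁ b))) //.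
  rewrite (linear_sw (f := @yd_assc k H M N P)) //.
  by apply: eq_sw => a1 a2; rewrite yd_asscE aut_ract autV_ract.
- move=> t; pure_ext t => t p; pure_ext t => m n.
  rewrite yd_asscE tens_coactE !sw_coact_tens // sw_coact_aut //.
  apply: eq_sw => x a; rewrite sw_coact_tens //; apply: eq_sw => y b.
  rewrite sw_coact_autV //; apply: eq_sw => z c.
  by rewrite yd_asscE hmulA autVK.
Qed.

(** [H]-linearity is the left counit law; colinearity holds because multiplying by [hone H] on the
    left is [aut H], matching the twist in [yd_lunit]. *)
Lemma lunit_closed M : is_yd_mor (@yd_lunit k H M).
Proof.
split.
- split=> [|t]; first exact: yd_lunit_linear.
  pure_ext t => x m.
  by rewrite !(aut_tens, yd_lunitE) linearZ.
- move=> t h; pure_ext t => x m.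
  rewrite yd_lunitE !tens_ractE (linear_sw (f := @yd_lunit k H M)) //.
  rewrite (linear_scale (f := fun x => x ◁ h)) // -{2}(autVK h) -aut_ract.
  rewrite -(sw_counitl h (f := fun y => (x : k) *: aut M (m ◁ y))) //; apply: eq_sw => a b.
  by rewrite yd_lunitE unit_ractE scalerA.
- move=> t; pure_ext t => x m.
  rewrite yd_lunitE sw_coact_tens // unit_coactE sweedler_pure //.
  rewrite (linear_scale (f := @coact _ _ M)) // [coact (aut M m)]sw_eta sw_coact_aut //.
  rewrite (linear_sw (f := fun u : htens M H => (x : k) *: u)) //; apply: eq_sw => y b.
  by rewrite yd_lunitE hmul1r pureZl.
Qed.

Lemma runit_closed M : is_yd_mor (@yd_runit k H M).
Proof.
split.
- split=> [|t]; first exact: yd_runit_linear.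
  pure_ext t => m x.
  by rewrite !(aut_tens, yd_runitE) linearZ.
- move=> t h; pure_ext t => m x.
  rewrite yd_runitE !tens_ractE (linear_sw (f := @yd_runit k H M)) //.
  rewrite (linear_scale (f := fun x => x ◁ h)) // -{2}(autVK h) -aut_ract.
  rewrite -(sw_counitr h (f := fun y => (x : k) *: aut M (m ◁ y))) //; apply: eq_sw => a b.
  by rewrite yd_runitE unit_ractE scalerA.
- move=> t; pure_ext t => m x.
  rewrite yd_runitE sw_coact_tens //.
  rewrite (linear_scale (f := @coact _ _ M)) // [coact (aut M m)]sw_eta sw_coact_aut //.
  rewrite (linear_sw (f := fun u : htens M H => (x : k) *: u)) //; apply: eq_sw => y b.
  by rewrite unit_coactE sweedler_pure // yd_runitE hmulr1 pureZl.
Qed.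

Lemma braid_closed M N : is_yd_mor (@yd_braid k H M N).
Proof.
split.
- split=> [|t]; first exact: yd_braid_linear.
  pure_ext t => m n.
  rewrite !(aut_tens, yd_braidE) sw_coact_aut // (linear_sw (f := aut _)) //.
  by apply: eq_sw => y b; rewrite !aut_tens aut_ract autK autVK.
- move=> t h; pure_ext t => m n.
  rewrite yd_braidE tens_ractE (linear_sw (f := @yd_braid k H M N)) // ract_sw.
  (* Acting and then braiding gives the right-hand side of the Yetter-Drinfeld condition for [n] and
     [h]; its left-hand side is braiding and then acting. *)
  transitivity (\sw_(a, b <- hcomul H h) \sw_(x, y <- coact (n ◁ b))
      (aut N x ⊗ (m ◁ autV H (a ⋆ y)))).
    apply: eq_sw => a b; rewrite yd_braidE; apply: eq_sw => x y.
    by rewrite autV_ract ract_ract autVK autV_hmul.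
  rewrite -(sw_yd n h (F := fun x y => aut N x ⊗ (m ◁ y))) //.
  apply: eq_sw => x y; rewrite tens_ractE; apply: eq_sw => a b.
  by rewrite ract_ract aut_ract !autVK.
- move=> t; pure_ext t => m n.
  rewrite yd_braidE [LHS](linear_sw (f := @coact _ _ (yd_tens N M))) //.
  (* Coassociativity replaces the second coaction on [n] by a comultiplication, freeing a leg [b]
     that acts on [m]. *)
  transitivity (\sw_(x, y <- coact n) \sw_(a, b <- hcomul H y)
    \sw_(z, w <- coact (autV M m ◁ aut H b)) ((x ⊗ z) ⊗ (aut H a ⋆ w))).
    transitivity (\sw_(x, y <- coact n) \sw_(z, a <- coact x)
       \sw_(v, w <- coact (autV M m ◁ y)) ((aut N z ⊗ v) ⊗ (aut H a ⋆ w))).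
      by apply: eq_sw => x y; rewrite tens_coactE sw_coact_aut.
    by rewrite sw_coactA //; apply: eq_sw => x y; apply: eq_sw => a b; rewrite autVK.
  transitivity (\sw_(x, a <- coact m) \sw_(y, b <- coact n) \sw_(b1, b2 <- hcomul H b)
    ((y ⊗ (autV M x ◁ b1)) ⊗ (a ⋆ aut H b2))).
    rewrite [RHS]sw_exchange; apply: eq_sw => y b.
    (* Inserting [aut H (autV H _)] produces the right-hand side of [sw_yd] for [autV M m] and
       [aut H b]. *)
    transitivity (\sw_(a, b <- hcomul H (aut H b)) \sw_(z, w <- coact (autV M m ◁ b))
       ((y ⊗ z) ⊗ aut H (autV H (a ⋆ w)))).
      rewrite sw_comul_aut //; apply: eq_sw => a1 a2; apply: eq_sw => z w.
      by rewrite autVK.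
    rewrite -(sw_yd _ _ (F := fun z w => (y ⊗ z) ⊗ aut H w)) // sw_coact_autV //.
    apply: eq_sw => x a; rewrite sw_comul_aut //; apply: eq_sw => b1 b2.
    by rewrite aut_hmul autVK !autK.
  rewrite sw_coact_tens //; apply: eq_sw => x a.
  transitivity (\sw_(y, b <- coact n) \sw_(z, w <- coact y)
    ((aut N z ⊗ (autV M x ◁ w)) ⊗ (a ⋆ b))).
    by rewrite sw_coactA //; apply: eq_sw => y b; apply: eq_sw => b1 b2; rewrite autVK.
  by apply: eq_sw => y b; rewrite yd_braidE (linear_sw (f := pure^~ (a ⋆ b))).
Qed.

End Closure.

(** * Closure, inverses of the constraints, and the pentagon *)

Section Laws.
Variables (k : comPzRingType) (H : mhbialg k).
Implicit Types (M N P Q : yd H) (h g : H).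

Lemma yd_cat_closed : yd_closed H.
Proof.
split.
- exact: tens_closed.
- exact: unit_closed.
- exact: tensm_closed.
- exact: assc_closed.
- exact: lunit_closed.
- exact: runit_closed.
- exact: braid_closed.
Qed.

(** Linearity and compatibility with the twist and the action are tested after the injective [f];
    for the coaction, [n] is rewritten as [f (g n)]. Hence a set-theoretic inverse already yields an
    isomorphism. *)
Lemma can2_yd_mor M N (f : yd_hom M N) (g : N -> M) :
  cancel f g -> cancel g f -> is_yd_mor g.
Proof.
move=> fK gK; have lf := yd_hom_linear f.
have lg : linear g by move=> a x y; apply: (can_inj fK); rewrite lf !gK.
split.
- by split=> // n; apply: (can_inj fK); rewrite yd_hom_aut !gK.
- by move=> n h; apply: (can_inj fK); rewrite yd_hom_ract !gK.
- move=> n; rewrite -{2}(gK n) sw_coact_hom // [LHS]sw_eta.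
  by apply: eq_sw => x y; rewrite fK.
Qed.

Lemma can2_is_iso M N (f : yd_hom M N) (g : N -> M) :
  cancel f g -> cancel g f -> @is_iso (yd_cat H) M N f.
Proof.
move=> fK gK; exists (YDHom (can2_yd_mor fK gK)).
by split; apply: yd_hom_eq.
Qed.

Definition asscV M N P (t : M ⊗ (N ⊗ P)) : (M ⊗ N) ⊗ P :=
  \sw_(m, u <- t) \sw_(n, p <- u) ((autV M m ⊗ n) ⊗ aut P p).

Lemma asscVE M N P m n p : @asscV M N P (m ⊗ (n ⊗ p)) = (autV M m ⊗ n) ⊗ aut P p.
Proof. by rewrite /asscV !sweedler_pure. Qed.

Lemma asscV_linear M N P : linear (@asscV M N P).
Proof. by rewrite /asscV; mlin. Qed.

Lemma yd_asscK M N P : cancel (@yd_assc k H M N P) (@asscV M N P).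
Proof.
have lV := @asscV_linear M N P; move=> t; pure_ext t => t p; pure_ext t => m n.
by rewrite yd_asscE asscVE autK autVK.
Qed.

Lemma asscVK M N P : cancel (@asscV M N P) (@yd_assc k H M N P).
Proof.
have lV := @asscV_linear M N P; move=> t; pure_ext t => m t; pure_ext t => n p.
by rewrite asscVE yd_asscE autK autVK.
Qed.

Lemma yd_lunitK M : cancel (@yd_lunit k H M) (fun m => (1 : k^o) ⊗ autV M m).
Proof.
move=> t; pure_ext t => x m.
by rewrite yd_lunitE linear_scale // autK pureZr -pureZl [_ *: _]mulr1.
Qed.

Lemma yd_lunitVK M : cancel (fun m => (1 : k^o) ⊗ autV M m) (@yd_lunit k H M).
Proof. by move=> m; rewrite yd_lunitE autVK scale1r. Qed.

Lemma yd_runitK M : cancel (@yd_runit k H M) (fun m => autV M m ⊗ (1 : k^o)).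
Proof.
move=> t; pure_ext t => m x.
by rewrite yd_runitE linear_scale // autK pureZl -pureZr [_ *: _]mulr1.
Qed.

Lemma yd_runitVK M : cancel (fun m => autV M m ⊗ (1 : k^o)) (@yd_runit k H M).
Proof. by move=> m; rewrite yd_runitE autVK scale1r. Qed.

(** On a pure tensor both composites give [aut M (aut M m) ⊗ (aut N n ⊗ (autV P p ⊗ autV Q (autV Q
    q)))]. *)
Lemma yd_pentagon M N P Q (t : yd_tens (yd_tens (yd_tens M N) P) Q) :
  yd_tensm idfun (@yd_assc k H N P Q) (@yd_assc k H M (yd_tens N P) Q
    (yd_tensm (@yd_assc k H M N P) idfun t))
  = @yd_assc k H M N (yd_tens P Q) (@yd_assc k H (yd_tens M N) P Q t).
Proof.
pure_ext t => t q; pure_ext t => t p; pure_ext t => m n.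
by rewrite !(yd_tensmE, yd_asscE, aut_tens, autV_tens).
Qed.

End Laws.

#[local] Hint Extern 0 =>
  match goal with |- context [@asscV] => exact: asscV_linear end : lin.

(** * The monoidal axioms and the hexagons *)

Section Monoidal.
Variables (k : comPzRingType) (H : mhbialg k).
Implicit Types (M N P Q : yd H) (h g : H).

(** The [autV] that [yd_assc] puts on the third factor cancels the [aut] of [yd_lunit]. *)
Lemma yd_triangle M N (t : yd_tens (yd_tens M (yd_unit H)) N) :
  yd_tensm idfun (@yd_lunit k H N) (@yd_assc k H M (yd_unit H) N t)
  = yd_tensm (@yd_runit k H M) idfun t.
Proof.
pure_ext t => t n; pure_ext t => m x.
by rewrite !(yd_tensmE, yd_asscE, yd_lunitE, yd_runitE) // autVK pureZl pureZr.
Qed.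

(** Morphisms are equal as soon as their underlying functions are, so the equations can be checked
    on elements for every closure proof [w]. *)
Lemma yd_cat_monoidal (w : yd_closed H) : is_monoidal (yd_monoidal w).
Proof.
split.
- move=> M N; apply: yd_hom_eq => t /=; pure_ext t => m n.
  by rewrite yd_tensmE.
- move=> M M' M'' N N' N'' f' f g' g; apply: yd_hom_eq => t /=.
  have lf := yd_hom_linear f; have lf' := yd_hom_linear f'.
  have lg := yd_hom_linear g; have lg' := yd_hom_linear g'.
  have lff : linear (f' \o f) by apply: linear_comp_fun.
  have lgg : linear (g' \o g) by apply: linear_comp_fun.
  pure_ext t => m n.
  by rewrite !yd_tensmE.
- move=> M M' N N' P P' f g h; apply: yd_hom_eq => t /=.
  have lf := yd_hom_linear f; have lg := yd_hom_linear g; have lh := yd_hom_linear h.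
  pure_ext t => t p; pure_ext t => m n.
  by rewrite !(yd_tensmE, yd_asscE) // yd_hom_aut yd_hom_autV.
- move=> M N f; apply: yd_hom_eq => t /=; have lf := yd_hom_linear f.
  pure_ext t => x m.
  by rewrite yd_tensmE // !yd_lunitE -yd_hom_aut linear_scale.
- move=> M N f; apply: yd_hom_eq => t /=; have lf := yd_hom_linear f.
  pure_ext t => m x.
  by rewrite yd_tensmE // !yd_runitE -yd_hom_aut linear_scale.
- move=> M N P; exact: (@can2_is_iso _ _ _ _ (assc (yd_monoidal w) M N P) _
    (@yd_asscK _ _ M N P) (@asscVK _ _ M N P)).
- move=> M; exact: (@can2_is_iso _ _ _ _ (lunit (yd_monoidal w) M) _
    (@yd_lunitK _ _ M) (@yd_lunitVK _ _ M)).
- move=> M; exact: (@can2_is_iso _ _ _ _ (runit (yd_monoidal w) M) _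
    (@yd_runitK _ _ M) (@yd_runitVK _ _ M)).
- by move=> M N P Q; apply: yd_hom_eq => t; apply: yd_pentagon.
- by move=> M N; apply: yd_hom_eq => t; apply: yd_triangle.
Qed.

(** The coaction on [N ⊗ P] multiplies the two [H]-legs, and acting by a product is acting twice. *)
Lemma yd_hexagon1 M N P (t : yd_tens (yd_tens M N) P) :
  @yd_assc k H N P M (@yd_braid k H M (yd_tens N P) (@yd_assc k H M N P t))
  = yd_tensm idfun (@yd_braid k H M P)
      (@yd_assc k H N M P (yd_tensm (@yd_braid k H M N) idfun t)).
Proof.
pure_ext t => t p; pure_ext t => m n.
rewrite yd_asscE yd_tensmE // !yd_braidE sw_coact_tens //.
rewrite (linear_sw (f := pure^~ p)) // !(linear_sw (f := @yd_assc _ _ _ _ _)) //.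
rewrite (linear_sw (f := yd_tensm _ _)) //; apply eq_sw => y b.
rewrite yd_asscE yd_tensmE // yd_braidE !sw_coact_autV //.
rewrite (linear_sw (f := @yd_assc _ _ _ _ _)) // (linear_sw (f := pure _)) //.
apply eq_sw => z c.
by rewrite aut_tens yd_asscE autK !autV_ract ract_ract !autVK autV_hmul.
Qed.

(** Acting on [M ⊗ N] comultiplies the [H]-leg of [p]; coassociativity of the coaction turns this
    into coacting twice on [p], as the two successive braidings do. *)
Lemma yd_hexagon2 M N P (t : yd_tens M (yd_tens N P)) :
  @asscV k H P M N (@yd_braid k H (yd_tens M N) P (@asscV k H M N P t))
  = yd_tensm (@yd_braid k H M P) idfun
      (@asscV k H M P N (yd_tensm idfun (@yd_braid k H N P) t)).
Proof.
pure_ext t => m t; pure_ext t => n p.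
rewrite asscVE yd_tensmE // !yd_braidE sw_coact_aut // (linear_sw (f := pure m)) //.
rewrite !(linear_sw (f := @asscV _ _ _ _ _)) // (linear_sw (f := yd_tensm _ _)) //.
transitivity (\sw_(z, c <- coact p) \sw_(x, a <- coact z)
  ((aut P (aut P x) ⊗ (autV M (autV M m) ◁ aut H a)) ⊗ (n ◁ aut H c))); last first.
  apply: eq_sw => z c; rewrite asscVE yd_tensmE // yd_braidE sw_coact_aut //.
  by rewrite (linear_sw (f := pure^~ _)) // aut_ract autVK.
rewrite sw_coactA //; apply: eq_sw => z c.
rewrite autV_tens tens_ractE sw_comul_aut // (linear_sw (f := pure _)) //.
rewrite (linear_sw (f := @asscV _ _ _ _ _)) //; apply: eq_sw => a b.
by rewrite asscVE autK autVK aut_ract autVK.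
Qed.

Lemma yd_braid_nat M M' N N' (f : yd_hom M M') (g : yd_hom N N') (t : yd_tens M N) :
  @yd_braid k H M' N' (yd_tensm f g t) = yd_tensm g f (@yd_braid k H M N t).
Proof.
have lf := yd_hom_linear f; have lg := yd_hom_linear g.
pure_ext t => m n.
rewrite yd_tensmE // !yd_braidE sw_coact_hom // (linear_sw (f := yd_tensm g f)) //.
by apply: eq_sw => y b; rewrite yd_tensmE // yd_hom_ract yd_hom_aut yd_hom_autV.
Qed.

Lemma yd_cat_prebraiding (w : yd_closed H) : is_prebraiding (yd_prebraiding w).
Proof.
split.
- by move=> M M' N N' f g; apply: yd_hom_eq => t; apply: yd_braid_nat.
- by move=> M N P; apply: yd_hom_eq => t; apply: yd_hexagon1.
(* The inverse associator is [asscV], a morphism because it inverts one. *)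
- exists (fun M N P : yd H =>
    YDHom (can2_yd_mor (f := YDHom (assc_closed M N P)) (@yd_asscK _ _ M N P) (@asscVK _ _ M N P))).
    by move=> M N P; split; apply: yd_hom_eq => t /=; [apply: yd_asscK | apply: asscVK].
  by move=> M N P; apply: yd_hom_eq => t; apply: yd_hexagon2.
Qed.

End Monoidal.

(** * Antimultiplicativity of the antipode *)

Section Antipode.
Variables (k : comPzRingType) (H : mhbialg k) (S : {linear H -> H}).
Hypothesis antiS : is_antipode S.
Implicit Types (g h : H).

(** The left antipode identity at [hone H] reads [S (hone H) ⋆ hone H = hone H], and its left side
    is [S (hone H)] because [S] commutes with [aut H]. *)
Lemma antipode1 : S (hone H) = hone H.
Proof.
have [Sa + _] := antiS; move/(_ (hone H)); rewrite sw_comul1 // hmulr1 -Sa aut_hone.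
by rewrite hcounit1 scale1r.
Qed.

(* S h ⋆ S g and S (g ⋆ h) are the left and right convolution inverses of the
   product H ⊗ H -> H, up to the structure automorphism. *)
Lemma antipodeM g h : S (g ⋆ h) = S h ⋆ S g.
Proof.
have [Sa Sl Sr] := antiS.
(* Counits inserted on [g] and [h] are expanded by the left antipode identity, so this sum equals
   [S (g ⋆ h)]. *)
transitivity (\sw_(a, b <- hcomul H g) \sw_(c, d <- hcomul H h)
  \sw_(a1, a2 <- hcomul H a) \sw_(c1, c2 <- hcomul H c)
    (((S c1 ⋆ S a1) ⋆ (a2 ⋆ c2)) ⋆ S (b ⋆ d))).
  transitivity (\sw_(a, b <- hcomul H g) (hcounit H a *: S (aut H b ⋆ h))).
    by rewrite (sw_counitl g (f := fun b => S (aut H b ⋆ h))) // autVK.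
  apply: eq_sw => a b.
  transitivity (\sw_(c, d <- hcomul H h) (hcounit H c *: (hcounit H a *: S (aut H b ⋆ aut H d)))).
    by rewrite (sw_counitl h (f := fun d => hcounit H a *: S (aut H b ⋆ aut H d))) // autVK.
  apply: eq_sw => c d; rewrite sw_exchange.
  transitivity (\sw_(c1, c2 <- hcomul H c)
     (hcounit H a *: (aut H (S c1 ⋆ c2) ⋆ S (b ⋆ d)))).
    rewrite -(linear_sw (f := fun x => hcounit H a *: (aut H x ⋆ S (b ⋆ d)))) // Sl.
    rewrite !linearZ /= aut_hone -aut_hmul (linear_scale (f := fun x => x ⋆ _)) //.
    by rewrite hmul1r Sa !scalerA mulrC.
  apply: eq_sw => c1 c2.
  transitivity ((aut H (S c1) ⋆ (autV H (hcounit H a *: hone H) ⋆ c2)) ⋆ S (b ⋆ d)).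
    rewrite linearZ /= autV_hone (linear_scale (f := fun x => x ⋆ c2)) // hmul1r.
    rewrite (linear_scale (f := hmul _)) // (linear_scale (f := fun x => x ⋆ _)) //.
    by rewrite aut_hmul.
  rewrite -Sl.
  transitivity (\sw_(a1, a2 <- hcomul H a)
      ((aut H (S c1) ⋆ (autV H (S a1 ⋆ a2) ⋆ c2)) ⋆ S (b ⋆ d))).
    by rewrite (linear_sw (f := fun x => (aut H (S c1) ⋆ (autV H x ⋆ c2)) ⋆ S (b ⋆ d))).
  apply: eq_sw => a1 a2.
  by congr (_ ⋆ _); rewrite autV_hmul hmulA_autV autVK hmulA aut_hmul !autVK.
(* Coassociativity in [g] and in [h] regroups the legs so that the product legs can be contracted
   with the last factor instead. *)
transitivity (\sw_(a, b <- hcomul H g) \sw_(b1, b2 <- hcomul H b)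
  \sw_(c, d <- hcomul H h) \sw_(d1, d2 <- hcomul H d)
    (((S (autV H c) ⋆ S (autV H a)) ⋆ (b1 ⋆ d1)) ⋆ S (aut H b2 ⋆ aut H d2))).
  rewrite [RHS]sw_comulA //; apply: eq_sw => a b.
  rewrite sw_exchange; apply: eq_sw => a1 a2.
  rewrite [RHS]sw_comulA //; apply: eq_sw => c d; apply: eq_sw => c1 c2.
  by rewrite !autK !autVK.
transitivity (\sw_(a, b <- hcomul H g) (hcounit H b *: (S h ⋆ aut H (S a)))).
  apply: eq_sw => a b.
  transitivity (\sw_(c, d <- hcomul H h)
      (hcounit H d *: (hcounit H b *: (aut H (S c) ⋆ aut H (S a))))).
    rewrite sw_exchange; apply: eq_sw => c d.
    (* The right antipode identity at the product [b ⋆ d], whose comultiplication is computed by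
       [sw_comulM]. *)
    transitivity ((S c ⋆ S a) ⋆ (hcounit H (b ⋆ d) *: hone H)).
      rewrite -Sr sw_comulM // (linear_sw (f := hmul (S c ⋆ S a))) //; apply: eq_sw => b1 b2.
      rewrite (linear_sw (f := hmul (S c ⋆ S a))) //; apply: eq_sw => d1 d2.
      by rewrite -aut_hmul Sa -hmulA aut_hmul -!Sa !autVK.
    by rewrite (linear_scale (f := hmul _)) // hmulr1 hcounitM mulrC -scalerA aut_hmul.
  rewrite (sw_counitr h (f := fun c => hcounit H b *: (aut H (S c) ⋆ aut H (S a)))) //.
  by rewrite -Sa autVK.
by rewrite (sw_counitr g (f := fun a => S h ⋆ aut H (S a))) // -Sa autVK.
Qed.

End Antipode.

(** * The inverse of the braiding *)

Section Braiding.
Variables (k : comPzRingType) (H : mhbialg k) (T : {linear H -> H}).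
(** [T] stands for the inverse antipode, represented by its commutation with [aut H] and by the
    antipode identities with the two legs exchanged. *)
Hypothesis Ta : forall h : H, T (aut H h) = aut H (T h).
Hypothesis Tl : forall h : H,
  \sw_(a, b <- hcomul H h) (T b ⋆ a) = hcounit H h *: hone H.
Hypothesis Tr : forall h : H,
  \sw_(a, b <- hcomul H h) (b ⋆ T a) = hcounit H h *: hone H.
Implicit Types (M N : yd H).

Definition braidV M N (t : N ⊗ M) : M ⊗ N :=
  \sw_(n, m <- t) \sw_(x, y <- coact n) ((autV M m ◁ T y) ⊗ aut N x).

Lemma braidVE M N n m :
  @braidV M N (n ⊗ m) = \sw_(x, y <- coact n) ((autV M m ◁ T y) ⊗ aut N x).
Proof. by rewrite /braidV sweedler_pure. Qed.

Lemma braidV_linear M N : linear (@braidV M N).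
Proof. by rewrite /braidV; mlin. Qed.

(** Coassociativity turns the two coactions on [n] into a comultiplication of its [H]-leg; [Tl]
    contracts the two resulting legs to a counit, which the counit law of the coaction removes. *)
Lemma braidVK M N : cancel (@braidV M N) (@yd_braid k H M N).
Proof.
have lV := @braidV_linear M N; move=> t; pure_ext t => n m.
rewrite braidVE (linear_sw (f := @yd_braid k H M N)) //.
transitivity (\sw_(x, y <- coact n) \sw_(z, w <- coact x)
  (aut N (aut N z) ⊗ (autV M m ◁ (autV H (T y) ⋆ w)))).
  apply: eq_sw => x y; rewrite yd_braidE sw_coact_aut //; apply: eq_sw => z w.
  by rewrite autV_ract ract_ract !autVK autK.
rewrite sw_coactA //.
transitivity (\sw_(x, y <- coact n) (hcounit H y *: (aut N x ⊗ m : htens N M))); last first.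
  by rewrite (sw_coact_counit n (f := fun x => aut N x ⊗ m)) // autVK.
apply: eq_sw => x y; rewrite autVK.
transitivity (aut N x ⊗ (autV M m ◁ (hcounit H y *: hone H))).
  rewrite -Tl (linear_sw (f := fun b => aut N x ⊗ (autV M m ◁ b))) //.
  by apply: eq_sw => a b; rewrite Ta autK.
rewrite (linear_scale (f := fun b => aut N x ⊗ (autV M m ◁ b))) //.
by rewrite ract_hone autVK.
Qed.

(** The same contraction, but the factors now meet in the opposite order, which calls for [Tr]. *)
Lemma yd_braidK M N : cancel (@yd_braid k H M N) (@braidV M N).
Proof.
have lV := @braidV_linear M N; move=> t; pure_ext t => m n.
rewrite yd_braidE (linear_sw (f := @braidV M N)) //.
transitivity (\sw_(x, y <- coact n) \sw_(z, w <- coact x)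
  ((autV M m ◁ (autV H y ⋆ T w)) ⊗ aut N (aut N z))).
  apply: eq_sw => x y; rewrite braidVE sw_coact_aut //; apply: eq_sw => z w.
  by rewrite autV_ract ract_ract !autVK Ta autK.
rewrite sw_coactA //.
transitivity (\sw_(x, y <- coact n) (hcounit H y *: (m ⊗ aut N x : htens M N))); last first.
  by rewrite (sw_coact_counit n (f := fun x => m ⊗ aut N x)) // autVK.
apply: eq_sw => x y; rewrite autVK.
transitivity ((autV M m ◁ (hcounit H y *: hone H)) ⊗ aut N x).
  rewrite -Tr (linear_sw (f := fun b => (autV M m ◁ b) ⊗ aut N x)) //.
  by apply: eq_sw => a b; rewrite autK.
rewrite (linear_scale (f := fun b => (autV M m ◁ b) ⊗ aut N x)) //.
by rewrite ract_hone autVK.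
Qed.

End Braiding.

Theorem theorem7p6 (k : comPzRingType) (H : mhbialg k) :
  exists w : yd_closed H,
    [/\ is_monoidal (yd_monoidal w),
        is_prebraiding (yd_prebraiding w) &
        (exists2 S : {linear H -> H}, is_antipode S & bijective S) ->
          is_braiding (yd_prebraiding w)].
Proof.
exists (yd_cat_closed H); split; [exact: yd_cat_monoidal | exact: yd_cat_prebraiding |].
case=> S antiS [T0 SK T0K]; split; first exact: yd_cat_prebraiding.
have [Sa Sl Sr] := antiS.
(* Bijectivity provides only a function [T0]; injectivity of [S] makes it linear. *)
have lT : linear T0 by move=> a x y; apply: (can_inj SK); rewrite linearP !T0K.
pose T := HB.pack T0 (GRing.isLinear.Build _ _ _ _ T0 lT) : {linear H -> H}.
have Sinj := can_inj SK.
have STK : cancel T S by [].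
have Ta h : T (aut H h) = aut H (T h) by apply: Sinj; rewrite STK Sa STK.
(* After applying the injective [S], antimultiplicativity turns [T b ⋆ a] into [S a ⋆ b], which is
   the left antipode identity; the right one gives [Tr] likewise. *)
have Tl h : \sw_(a, b <- hcomul H h) (T b ⋆ a) = hcounit H h *: hone H.
  apply: Sinj; rewrite linear_sw // linearZ /= antipode1 // -Sl.
  by apply: eq_sw => a b; rewrite antipodeM // STK.
have Tr h : \sw_(a, b <- hcomul H h) (b ⋆ T a) = hcounit H h *: hone H.
  apply: Sinj; rewrite linear_sw // linearZ /= antipode1 // -Sr.
  by apply: eq_sw => a b; rewrite antipodeM // STK.
move=> M N.
exact: (@can2_is_iso _ _ _ _ (yd_prebraiding (yd_cat_closed H) M N) (@braidV _ _ T M N)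
  (@yd_braidK _ _ _ Ta Tr M N) (@braidVK _ _ _ Ta Tl M N)).
Qed.
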